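(* Let $p\in(0,1]$, let $N\ge1$, $y_1,\dots,y_N\in\mathbf{Z}$, $\mathbf{e}=\bigcup_{j=1}^N\{y_j-1,y_j\}$, and let $U=SC$ with $C=F_{\mathbf{e}}C_1+(1-F_{\mathbf{e}})C_2$, where the position-dependent coin $C_2$ is such that there exist $\rho,M>0$ with $\|C_2(x)-C_0\|_\infty\le Me^{-\rho\langle x\rangle}$ for all $x\in\mathbf{Z}$, and there exists $\delta>0$ with $|a_2(x)|\ge\delta$ for all $x\in\mathbf{Z}$. (1) The continuous (i.e. essential) spectrum of $U$ is $\sigma_{ess}(U)=\{e^{i\theta} : \theta\in J_\gamma\}$. (2) For any $\gamma'\in[0,2\pi)$, we have $\pm ie^{i\gamma'/2}\in\sigma_p(U)$, and one can take associated eigenfunctions $\Psi_\pm\in\mathcal{H}$ such that $\mathrm{supp}\,\Psi_\pm\subset\mathbf{e}$. (3) If $(\gamma'+\pi)/2\in J_\gamma\setminus J_{\gamma,\mathcal{T}}$, then $\pm ie^{i\gamma'/2}\in\sigma_p(U)\cap(\sigma_{ess}(U)\setminus\mathcal{T})$. Any associated eigenfunctions $\Psi_\pm$ vanish in $\{x\in\mathbf{Z} : x>x^*\text{ or }x<x_*\}$, where $x^*=\max\{x\in\mathbf{e}\}$ and $x_*=\min\{x\in\mathbf{e}\}$.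
   Context: Let $\mathcal{H}=\ell^2(\mathbf{Z};\mathbf{C}^2)$, with elements $\psi(x)=(\psi^{(0)}(x),\psi^{(1)}(x))^T$. The shift $S$ is $(S\psi)(x)=(\psi^{(0)}(x+1),\psi^{(1)}(x-1))^T$. For $A\subset\mathbf{Z}$, $F_A$ is the operator $(F_A\psi)(x)=\psi(x)$ for $x\in A$ and $0$ for $x\notin A$. Coin operators act by pointwise matrix multiplication. The constant coin $C_0$ is $$C_0=\begin{bmatrix} pe^{i\alpha} & qe^{i\beta}\\ -qe^{-i(\beta-\gamma)} & pe^{-i(\alpha-\gamma)}\end{bmatrix},\qquad \alpha,\beta,\gamma\in[0,2\pi),\ p,q\in[0,1],\ p^2+q^2=1.$$ The constant coin $C_1$ is $$C_1=e^{i\gamma'/2}\begin{bmatrix}0&e^{i(\beta'-\gamma'/2)}\\-e^{-i(\beta'-\gamma'/2)}&0\end{bmatrix},\qquad \beta',\gamma'\in[0,2\pi).$$ The coin $C_2$ is $C_2(x)=\begin{bmatrix}a_2(x)&b_2(x)\\c_2(x)&d_2(x)\end{bmatrix}\in U(2)$ for $x\in\mathbf{Z}$. $\|A\|_\infty=\max_{j,k}|a_{jk}|$ for a $2\times2$ matrix, $\langle x\rangle=\sqrt{1+x^2}$. Define $J_\gamma=[\arccos p+\gamma/2,\pi-\arccos p+\gamma/2]\cup[\pi+\arccos p+\gamma/2,2\pi-\arccos p+\gamma/2]$, $J_{\gamma,\mathcal{T}}=\{\arccos p+\gamma/2,\ \pi-\arccos p+\gamma/2,\ \pi+\arccos p+\gamma/2,\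 2\pi-\arccos p+\gamma/2\}$, and $\mathcal{T}=\{e^{i\theta}\in\sigma_{ess}(U) : \theta\in J_{\gamma,\mathcal{T}}\}$. $\sigma_p(U)$ is the set of eigenvalues of $U$ in $\mathcal{H}$; $\sigma_{ess}(U)=\sigma(U)\setminus\sigma_d(U)$, where $\sigma_d(U)$ is the set of isolated points of $\sigma(U)$ that are eigenvalues of finite multiplicity. *)

(* Defs.v *)
(* MathComp and MathComp-Analysis; complex numbers are R[i] for a realType R. *)
From HB Require Import structures.
From mathcomp Require Import all_boot all_order all_algebra.
From mathcomp Require Import all_classical all_reals all_analysis.
From mathcomp Require Import complex.

Set Implicit Arguments.
Unset Strict Implicit.
Unset Printing Implicit Defensive.

Import Order.TTheory GRing.Theory Num.Theory.
Import numFieldNormedType.Exports.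

Local Open Scope classical_set_scope.
Local Open Scope ring_scope.
Local Open Scope complex_scope.

Definition cmod (R : realType) (z : R[i]) : R := Normc.normc z.

Definition expi (R : realType) (t : R) : R[i] := cos t +i* sin t.

Definition mx22 (T : Type) (a b c d : T) : 'M[T]_2 :=
  \matrix_(i < 2, j < 2) if i == 0 then (if j == 0 then a else b)
                         else (if j == 0 then c else d).

Section Ell2.
Variable R : realType.

Definition sqnorm2 (v : 'cV[R[i]]_2) : R := \sum_i cmod (v i 0) ^+ 2.

Definition sqsum (psi : int -> 'cV[R[i]]_2) : \bar R :=
  \esum_(x in [set: int]) (sqnorm2 (psi x))%:E.

Definition square_summable : {pred (int -> 'cV[R[i]]_2)} :=
  fun psi => (sqsum psi < +oo)%E.

Lemma sqnorm2_ge0 v : 0 <= sqnorm2 v.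
Proof. by apply: sumr_ge0 => i _; exact: sqr_ge0. Qed.

Lemma cmod_normr (z : R[i]) : (cmod z)%:C = `|z|.
Proof. by case: z. Qed.

Lemma cmod_ge0 (z : R[i]) : 0 <= cmod z.
Proof. by case: z => a b; exact: sqrtr_ge0. Qed.

Lemma sqnorm2E (v : 'cV[R[i]]_2) :
  (sqnorm2 v)%:C = ((v ^t*)%sesqui *m v) 0 0.
Proof.
rewrite mxE rmorph_sum /=; apply: eq_bigr => i _.
by rewrite rmorphXn /= cmod_normr !mxE sqr_normc mulrC.
Qed.

Lemma sqnorm2D u v : sqnorm2 (u + v) <= 2 * (sqnorm2 u + sqnorm2 v).
Proof.
rewrite /sqnorm2 -big_split mulr_sumr; apply: ler_sum => i _ /=.
rewrite mxE; set a := u i 0; set b := v i 0.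
apply: (@le_trans _ _ ((cmod a + cmod b) ^+ 2)).
  rewrite ler_sqr ?nnegrE ?addr_ge0 ?cmod_ge0 //; exact: le_normcD.
rewrite -subr_ge0 mulr_natl mulr2n sqrrD mulr2n.
set s := cmod a; set t := cmod b.
suff -> : s ^+ 2 + t ^+ 2 + (s ^+ 2 + t ^+ 2) - (s ^+ 2 + (s * t + s * t) + t ^+ 2)
   = (s - t) ^+ 2 by exact: sqr_ge0.
rewrite sqrrB mulr2n.
rewrite [X in _ + _ - X]addrAC opprD addrA addrK.
by rewrite addrAC.
Qed.

Lemma sqnorm2Z a v : sqnorm2 (a *: v) = cmod a ^+ 2 * sqnorm2 v.
Proof.
rewrite /sqnorm2 mulr_sumr; apply: eq_bigr => i _.
by rewrite mxE -exprMn /cmod Normc.normcM.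
Qed.

Lemma sqnorm2_unitary (A : 'M[R[i]]_2) v :
  A \is unitarymx -> sqnorm2 (A *m v) = sqnorm2 v.
Proof.
move=> /unitarymxP/mulmx1C hA; apply: complexI.
rewrite !sqnorm2E trmx_mul map_mxM -mulmxA (mulmxA _ A) hA mul1mx //.
Qed.

Lemma summable_dominated (k : R) (f g : int -> R) :
  (forall x, 0 <= g x) -> (forall x, f x <= k * g x) ->
  (\esum_(x in [set: int]) (g x)%:E < +oo)%E ->
  (\esum_(x in [set: int]) (f x)%:E < +oo)%E.
Proof.
move=> g0 fg gfin; set n := (Num.truncn k).+1.
apply: (@le_lt_trans _ _
   (\esum_(x in [set: int]) (\sum_(j < n) (g x)%:E)%E)%E); last first.
  rewrite esum_sum; last by move=> *; rewrite lee_fin.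
  by apply: lte_sum_pinfty.
apply: le_esum => x _; rewrite sumEFin lee_fin sumr_const card_ord.
apply: (le_trans (fg x)); rewrite -mulr_natl ler_wpM2r //.
by rewrite ltW // truncnS_gt.
Qed.

Fact square_summable_submod : submod_closed square_summable.
Proof.
split.
  rewrite unfold_in /sqsum esum1 ?ltry // => x _.
  by rewrite /sqnorm2 big1 // => i _; rewrite mxE /cmod Normc.normc0 expr0n.
move=> a u v; rewrite !unfold_in /sqsum => hu hv.
have h : (\esum_(x in [set: int]) (sqnorm2 (u x) + sqnorm2 (v x))%:E < +oo)%E.
  under eq_esum do rewrite EFinD.
  by rewrite esumD ?lte_add_pinfty // => *; rewrite lee_fin sqnorm2_ge0.
apply: (@summable_dominated (2 * Num.max 1 (cmod a ^+ 2))) h.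
  by move=> x; rewrite addr_ge0 ?sqnorm2_ge0.
move=> x; apply: (le_trans (sqnorm2D _ _)); rewrite sqnorm2Z -[leRHS]mulrA.
rewrite ler_pM2l ?ltr0n //.
rewrite mulrDr lerD // ?ler_wpM2r ?sqnorm2_ge0 // ?le_max ?lexx ?orbT //.
by rewrite ler_peMl ?sqnorm2_ge0 // le_max lexx.
Qed.

HB.instance Definition _ := GRing.isSubmodClosed.Build R[i]
  (int -> 'cV[R[i]]_2) square_summable square_summable_submod.

Record ell2 := Ell2 {
  ell2_fun :> int -> 'cV[R[i]]_2;
  ell2P : ell2_fun \in square_summable }.

HB.instance Definition _ := [isSub for ell2_fun].
HB.instance Definition _ := [Choice of ell2 by <:].
HB.instance Definition _ := [SubChoice_isSubLmodule of ell2 by <:].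

Definition ell2_norm (psi : ell2) : R := Num.sqrt (fine (sqsum psi)).

Fact shift_subproof (psi : ell2) :
  (fun x => \col_(i < 2) if i == 0 then psi (x + 1) 0 0
                         else psi (x - 1) 1 0) \in square_summable.
Proof.
have hsh (y : int) :
    (\esum_(x in [set: int]) (sqnorm2 (psi (x + y)))%:E < +oo)%E.
  have := ell2P psi; rewrite unfold_in /sqsum.
  rewrite (@reindex_esum _ _ _ [set: int] [set: int] (fun x : int => x + y)) //.
  rewrite setTT_bijective.
  by exists (fun x : int => x - y) => x; [exact: addrK|exact: subrK].
rewrite unfold_in /sqsum.
apply: (@summable_dominated 1 _
  (fun x : int => sqnorm2 (psi (x + 1)) + sqnorm2 (psi (x + (- 1))))).
- by move=> x; rewrite addr_ge0 ?sqnorm2_ge0.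
- move=> x; rewrite mul1r /sqnorm2 !big_ord_recl !big_ord0 !addr0 !mxE /=.
  rewrite lerD // ?lerDl ?sqr_ge0 //.
  have -> : lift ord0 ord0 = 1 :> 'I_2 by exact/val_inj.
  by rewrite lerDr sqr_ge0.
- under eq_esum do rewrite EFinD.
  by rewrite esumD ?lte_add_pinfty // => *; rewrite lee_fin sqnorm2_ge0.
Qed.

Definition shift (psi : ell2) : ell2 := Ell2 (shift_subproof psi).

Fact shift_linear : linear shift.
Proof.
move=> a u v; apply: val_inj; apply/funext => x; apply/colP => i.
by rewrite !mxE; case: ifP.
Qed.

HB.instance Definition _ :=
  GRing.isLinear.Build R[i] ell2 ell2 _ shift shift_linear.

Fact cutoff_subproof (A : set int) (psi : ell2) :
  (fun x => if x \in A then psi x else 0) \in square_summable.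
Proof.
have := ell2P psi; rewrite !unfold_in; apply: le_lt_trans.
apply: le_esum => x _; rewrite lee_fin; case: ifP => // _.
rewrite [leLHS]big1 ?sqnorm2_ge0 // => i _.
by rewrite mxE /cmod Normc.normc0 expr0n.
Qed.

Definition cutoff (A : set int) (psi : ell2) : ell2 :=
  Ell2 (cutoff_subproof A psi).

Fact cutoff_linear A : linear (cutoff A).
Proof.
move=> a u v; apply: val_inj; apply/funext => x.
change ((if x \in A then a *: u x + v x else 0) =
  a *: (if x \in A then u x else 0) + (if x \in A then v x else 0)).
case: ifP => _ //.
by rewrite scaler0 addr0.
Qed.

HB.instance Definition _ A :=
  GRing.isLinear.Build R[i] ell2 ell2 _ (cutoff A) (cutoff_linear A).

Record coin := Coin {
  coin_mx :> int -> 'M[R[i]]_2;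
  coin_unitary : forall x, coin_mx x \is unitarymx }.

Fact coin_op_subproof (C : coin) (psi : ell2) :
  (fun x => C x *m psi x) \in square_summable.
Proof.
have := ell2P psi; rewrite !unfold_in; apply: le_lt_trans.
by apply: le_esum => x _; rewrite sqnorm2_unitary // coin_unitary.
Qed.

Definition coin_op (C : coin) (psi : ell2) : ell2 :=
  Ell2 (coin_op_subproof C psi).

Fact coin_op_linear C : linear (coin_op C).
Proof.
move=> a u v; apply: val_inj; apply/funext => x.
change (C x *m (a *: u x + v x) = a *: (C x *m u x) + C x *m v x).
by rewrite mulmxDr scalemxAr.
Qed.

HB.instance Definition _ C :=
  GRing.isLinear.Build R[i] ell2 ell2 _ (coin_op C) (coin_op_linear C).

Definition walk (A : set int) (C1 C2 : coin) : {linear ell2 -> ell2} :=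
  shift \o ((cutoff A \o coin_op C1) \+ ((idfun \- cutoff A) \o coin_op C2)).

Definition supp (psi : ell2) : set int := [set x | psi x != 0].

Definition bounded_op (T : ell2 -> ell2) : Prop :=
  exists K : R, forall psi, ell2_norm (T psi) <= K * ell2_norm psi.

Section Spectrum.
Variable U : {linear ell2 -> ell2}.

Definition resolvent_set : set R[i] :=
  [set l | exists B : {linear ell2 -> ell2},
    [/\ bounded_op B,
        forall psi, B (U psi - l *: psi) = psi
      & forall psi, U (B psi) - l *: B psi = psi]].

Definition spectrum : set R[i] := ~` resolvent_set.

Definition eigenspace (l : R[i]) : set ell2 := [set psi | U psi = l *: psi].

Definition eigenvector (l : R[i]) (psi : ell2) : Prop :=
  psi != 0 /\ eigenspace l psi.

Definition point_spectrum : set R[i] := [set l | exists psi, eigenvector l psi].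

(* The v i need not lie in the eigenspace, nor be independent. *)
Definition finite_multiplicity (l : R[i]) : Prop :=
  exists (n : nat) (v : 'I_n -> ell2), forall psi, eigenspace l psi ->
    exists c : 'I_n -> R[i], psi = \sum_i c i *: v i.

(* R[i] carries its norm topology only as the regular module R[i]^o. *)
Definition discrete_spectrum : set R[i] :=
  [set l | [/\ isolated (spectrum : set R[i]^o) l, point_spectrum l
             & finite_multiplicity l]].

Definition essential_spectrum : set R[i] := spectrum `\` discrete_spectrum.

End Spectrum.

Definition coin0_mx (p q alpha beta gamma : R) : 'M[R[i]]_2 :=
  mx22 (p%:C * expi alpha) (q%:C * expi beta)
       (- (q%:C * expi (- (beta - gamma)))) (p%:C * expi (- (alpha - gamma))).

Definition coin1_mx (beta' gamma' : R) : 'M[R[i]]_2 :=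
  expi (gamma' / 2) *: mx22 0 (expi (beta' - gamma' / 2))
                            (- expi (- (beta' - gamma' / 2))) 0.

Lemma expi_conj (t : R) : expi t * (expi t)^* = 1.
Proof.
by rewrite -sqr_normc -cmod_normr /cmod /= cos2Dsin2 sqrtr1 expr1n.
Qed.

Fact coin1_unitary beta' gamma' (x : int) : coin1_mx beta' gamma' \is unitarymx.
Proof.
apply/unitarymxP/matrixP => i j.
rewrite !mxE !big_ord_recl big_ord0 addr0 !mxE /=.
set a := expi (gamma' / 2); set b := expi (_ - _); set c := expi (- _).
have ha : a * a^* = 1 := expi_conj _.
have hb : b * b^* = 1 := expi_conj _.
have hc : c * c^* = 1 := expi_conj _.
case: i => [[|[|//]] hi]; case: j => [[|[|//]] hj] /=;
  rewrite ?rmorphM ?rmorphN ?rmorph0 ?(mulr0, mul0r, addr0, add0r) //.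
  by rewrite mulrACA ha hb mulr1.
by rewrite mulrACA ha mulrNN hc mulr1.
Qed.

Definition coin1 (beta' gamma' : R) : coin := Coin (coin1_unitary beta' gamma').

(* Bands of the free walk S C_0: its quasi-energies t satisfy
   cos (t - gamma / 2) = p cos k for a real momentum k. *)
Definition arcs (p gamma : R) : set R :=
  `[acos p + gamma / 2, pi - acos p + gamma / 2] `|`
  `[pi + acos p + gamma / 2, 2 * pi - acos p + gamma / 2].

Definition arc_ends (p gamma : R) : set R :=
  [set t | [\/ t = acos p + gamma / 2, t = pi - acos p + gamma / 2,
    t = pi + acos p + gamma / 2 | t = 2 * pi - acos p + gamma / 2]].

Definition thresholds (U : {linear ell2 -> ell2}) (p gamma : R) : set R[i] :=
  essential_spectrum U `&` (@expi R @` arc_ends p gamma).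

Definition japanese_bracket (x : int) : R := Num.sqrt (1 + x%:~R ^+ 2).

End Ell2.

Definition pair_union (N : nat) (y : 'I_N -> int) : set int :=
  \bigcup_(j in [set: 'I_N]) [set y j - 1; y j].

Definition is_max (A : set int) (m : int) : Prop := A m /\ ubound A m.
Definition is_min (A : set int) (m : int) : Prop := A m /\ lbound A m.

(* Main.v *)
(* The coin on e is off-diagonal, hence reflects completely: the two states on
   either side of the link (y - 1, y) span a two-dimensional invariant space,
   which gives the eigenvalues +- i e^(i gamma' / 2).

   Essential spectrum. The free walk U0 = S C0 satisfies
   U0^2 + e^(i gamma) = H U0, where H is e^(i gamma / 2) times a hopping of norm
   at most 2 p. Hence U0 - l is bounded below when |l| = 1 and l is off the
   arcs, and so is U - l on the functions that vanish on a large box. Since U is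
   unitary, this makes l a resolvent point or an isolated eigenvalue of finite
   multiplicity: outside finitely many coordinates U - l is bounded below, and
   eigenvectors for nearby eigenvalues are orthogonal to its kernel.
   Conversely, plane waves cut off to [n, 2 n) show that the arcs lie in the
   spectrum, and they have no isolated points.

   Vanishing outside [x_*, x^*]. For l in the interior of the arcs the free
   transfer matrix is elliptic and preserves a norm on C^2; along an
   eigenfunction this norm changes by summable relative amounts, so it can tend
   to 0 only by vanishing far out. As a_2 has no zeros, the recursion carries
   the zeros inwards up to e. *)

Require Import Defs.
From HB Require Import structures.
From mathcomp Require Import all_boot all_order all_algebra.
From mathcomp Require Import all_classical all_reals all_analysis.
From mathcomp Require Import complex.
From mathcomp Require Import ring lra zify finmap.
Import Order.TTheory GRing.Theory Num.Theory.
Import numFieldNormedType.Exports.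
Local Open Scope classical_set_scope.
Local Open Scope ring_scope.
Local Open Scope complex_scope.
Set Implicit Arguments.
Unset Strict Implicit.

(** Everything is read off the squared norm: no inner product, adjoint or Fourier transform appears.
    Diagonalization of the free walk is replaced by the relation between [U0^2] and [H]: for
    [l = e^(i t)] the number [l^2 + e^(i gamma)] has modulus [2 |cos (t - gamma / 2)|], which
    exceeds the bound [2 p] on [H] precisely off the arcs. The obstacle is that for the perturbed
    walk the lower bound holds only on functions vanishing on a box. The coordinates of the box are
    released one at a time; a coordinate resists only if some kernel vector is dual to it, so the
    process ends with a basis of the kernel dual to the remaining coordinates. This basis gives
    finite multiplicity, and also the projection needed to exclude nearby eigenvalues. On the arcs,
    the wave on [[n, 2 n)] has mass proportional to [n], while the cut costs a bounded amount at its
    ends and the coins there approach [C0]. For the vanishing, exponential decay of [C2 - C0] makes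
    the relative changes summable; square-summability enters through boundedness and through
    arbitrarily small values far out. *)

Local Notation shift := Defs.shift.

(** * Moduli and sums over the integers *)

Section Modulus.
Variable R : realType.
Implicit Types z w : R[i].

Lemma cmodM z w : cmod (z * w) = cmod z * cmod w.
Proof. exact: Normc.normcM. Qed.

Lemma cmod_triangle z w : cmod (z + w) <= cmod z + cmod w.
Proof. exact: le_normcD. Qed.

Lemma cmod0 : cmod (0 : R[i]) = 0.
Proof. exact: Normc.normc0. Qed.

Lemma cmodN z : cmod (- z) = cmod z.
Proof. exact: normcN. Qed.

Lemma cmod_eq0 z : (cmod z == 0) = (z == 0).
Proof.
apply/eqP/eqP => [/Normc.eq0_normc//|->]; exact: cmod0.
Qed.

Lemma cmod_sqr z : cmod z ^+ 2 = complex.Re z ^+ 2 + complex.Im z ^+ 2.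
Proof. by case: z => a b; rewrite /cmod /= sqr_sqrtr // addr_ge0 ?sqr_ge0. Qed.

Lemma cmodR (r : R) : cmod r%:C = `|r|.
Proof. by rewrite /cmod /= expr0n addr0 sqrtr_sqr. Qed.

Lemma cmod_expi (t : R) : cmod (expi t) = 1.
Proof. by rewrite /cmod /= cos2Dsin2 sqrtr1. Qed.

Lemma cmodV z : cmod z^-1 = (cmod z)^-1.
Proof. exact: Normc.normcV. Qed.

Lemma cmod_conj z : cmod z^* = cmod z.
Proof. by apply/complexI; rewrite !cmod_normr normcJ. Qed.

Lemma cmod1 : cmod (1 : R[i]) = 1.
Proof. exact: Normc.normc1. Qed.

Lemma cmod_gt0 z : (0 < cmod z) = (z != 0).
Proof. by rewrite lt_def cmod_eq0 cmod_ge0 andbT. Qed.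

Lemma mul_conj z : z * z^* = (cmod z ^+ 2)%:C.
Proof. by rewrite -sqr_normc rmorphXn /= cmod_normr. Qed.

Lemma expiD (s t : R) : expi (s + t) = expi s * expi t.
Proof. by rewrite /expi cosD sinD; congr (_ +i* _); ring. Qed.

Lemma expi0 : expi (0 : R) = 1.
Proof. by rewrite /expi cos0 sin0. Qed.

Lemma expiN (t : R) : expi (- t) = (expi t)^*.
Proof. by rewrite /expi cosN sinN. Qed.

End Modulus.

Section Sums.
Variable R : realType.
Implicit Types f g : int -> R.

Definition zsum f : R := fine (\esum_(x in [set: int]) (f x)%:E).
Definition zsummable f : Prop :=
  (forall x, 0 <= f x) /\ (\esum_(x in [set: int]) (f x)%:E < +oo)%E.

Lemma zsumE f : zsummable f -> (zsum f)%:E = \esum_(x in [set: int]) (f x)%:E.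
Proof.
move=> [f0 fs]; rewrite fineK // ge0_fin_numE // esum_ge0 // => x _.
by rewrite lee_fin.
Qed.

Lemma zsummableD f g : zsummable f -> zsummable g ->
  zsummable (fun x => f x + g x).
Proof.
move=> [f0 fs] [g0 gs]; split => [x|]; first exact: addr_ge0.
under eq_esum do rewrite EFinD.
by rewrite esumD ?lte_add_pinfty // => *; rewrite lee_fin.
Qed.

Lemma zsumD f g : zsummable f -> zsummable g ->
  zsum (fun x => f x + g x) = zsum f + zsum g.
Proof.
move=> hf hg; apply: EFin_inj; rewrite EFinD !zsumE //; last exact: zsummableD.
under eq_esum do rewrite EFinD.
by rewrite esumD // => *; rewrite lee_fin; [apply: hf.1|apply: hg.1].
Qed.

Lemma zsum_eq43 (a b c d a' b' c' : int -> R) :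
  zsummable a -> zsummable b -> zsummable c -> zsummable d ->
  zsummable a' -> zsummable b' -> zsummable c' ->
  (forall x, a x + (b x + (c x + d x)) = a' x + (b' x + c' x)) ->
  zsum a + (zsum b + (zsum c + zsum d)) = zsum a' + (zsum b' + zsum c').
Proof.
move=> ha hb hc hd ha' hb' hc' h.
have hcd := zsummableD hc hd; have hbcd := zsummableD hb hcd.
have hbc' := zsummableD hb' hc'.
rewrite -(zsumD hc hd) -(zsumD hb hcd) -(zsumD ha hbcd).
rewrite -(zsumD hb' hc') -(zsumD ha' hbc').
by congr zsum; apply/funext.
Qed.

Lemma zsum_le f g : (forall x, 0 <= f x) -> zsummable g ->
  (forall x, f x <= g x) -> zsum f <= zsum g.
Proof.
move=> f0 hg fg; have hf : zsummable f.
  split=> //; apply: le_lt_trans hg.2.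
  by apply: le_esum => x _; rewrite lee_fin.
by rewrite -lee_fin !zsumE //; apply: le_esum => x _; rewrite lee_fin.
Qed.

Lemma zsum_ge0 f : (forall x, 0 <= f x) -> 0 <= zsum f.
Proof. by move=> f0; apply/fine_ge0/esum_ge0 => x _; rewrite lee_fin. Qed.

Lemma zsummableZ k f : 0 <= k -> zsummable f -> zsummable (fun x => k * f x).
Proof.
move=> k0 [f0 fs]; split=> [x|]; first exact: mulr_ge0.
exact: (@summable_dominated _ k _ f).
Qed.

Lemma zsum_seq f (s : seq int) : uniq s -> zsummable f ->
  \sum_(x <- s) f x <= zsum f.
Proof.
move=> us hf; rewrite -lee_fin zsumE //.
apply: ereal_sup_ubound; exists [set` s] => //=.
  by split=> //=; exact: finite_seq.
by rewrite -sumEFin -fsbig_seq.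
Qed.

(** An unordered sum of nonnegative terms is the supremum of its finite partial sums, so a uniform
    bound on these gives summability as well. This carries the Fatou argument in [N2_complete]. *)
Lemma zsum_bound f M : (forall x, 0 <= f x) ->
  (forall s : seq int, uniq s -> \sum_(x <- s) f x <= M) ->
  zsummable f /\ zsum f <= M.
Proof.
move=> f0 fM.
have h : (\esum_(x in [set: int]) (f x)%:E <= M%:E)%E.
  apply: ge_ereal_sup => _ [X [fX _] <-].
  rewrite fsbig_finite //= sumEFin lee_fin.
  exact/fM/fset_uniq.
have hf : zsummable f by split=> //; apply: (le_lt_trans h); rewrite ltry.
by split => //; rewrite -lee_fin zsumE.
Qed.

Lemma zsumZ_le k f : 0 <= k -> zsummable f ->
  zsum (fun x => k * f x) <= k * zsum f.
Proof.
move=> k0 hf; apply: (zsum_bound _ _).2 => [x|s us].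
  by rewrite mulr_ge0 //; exact: hf.1.
by rewrite -mulr_sumr ler_wpM2l // zsum_seq.
Qed.

Lemma zsumZ k f : 0 <= k -> zsummable f ->
  zsum (fun x => k * f x) = k * zsum f.
Proof.
move=> k0 hf; apply/eqP; rewrite eq_le zsumZ_le //=.
case: (eqVneq k 0) => [->|kn0].
  by rewrite mul0r zsum_ge0 // => x; rewrite mul0r.
have kp : 0 < k by rewrite lt_def kn0.
rewrite -ler_pdivlMl //.
apply: le_trans (zsumZ_le _ _); rewrite ?invr_ge0 //; last exact: zsummableZ.
have -> // : (fun x => k^-1 * (k * f x)) = f.
by apply/funext => x; rewrite mulKf.
Qed.

Lemma zsum_bij f (h : int -> int) : bijective h -> zsummable f ->
  zsummable (fun x => f (h x)) /\ zsum (fun x => f (h x)) = zsum f.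
Proof.
move=> hb hf.
have E : \esum_(x in [set: int]) (f x)%:E = \esum_(x in [set: int]) (f (h
  x))%:E.
  by rewrite (@reindex_esum _ _ _ [set: int] [set: int] h) // setTT_bijective.
split; last by rewrite /zsum E.
by split=> [x|]; [exact: hf.1|rewrite -E; exact: hf.2].
Qed.

End Sums.

(** * Isolated spectrum of isometries *)

Section SquareNormedSpace.
Variable R : realType.

(* The squared norm of a complex Hilbert space, without its inner product:
   sqn_young is the triangle inequality and sqn_quad the additivity of the
   real inner product (Jordan-von Neumann). *)
Record hilbert_sqnorm (V : lmodType R[i]) (N : V -> R) : Prop := {
  sqn_ge0 : forall u, 0 <= N u;
  sqn_eq0 : forall u, N u = 0 -> u = 0;
  sqnZ : forall (a : R[i]) u, N (a *: u) = cmod a ^+ 2 * N u;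
  sqn_young : forall (s : R) u v, 0 < s ->
    N (u + v) <= (1 + s) * N u + (1 + s^-1) * N v;
  sqn_quad : forall u v w,
    N (u + v + w) + (N u + (N v + N w)) = N (u + v) + (N (u + w) + N (v + w));
  sqn_complete : forall x : nat -> V,
    (forall e : R, 0 < e -> exists n0 : nat, forall n m,
      (n0 <= n)%N -> (n0 <= m)%N -> N (x n - x m) <= e) ->
    exists u, forall e : R, 0 < e -> exists n0 : nat, forall n,
      (n0 <= n)%N -> N (x n - u) <= e }.

Variables (V : lmodType R[i]) (N : V -> R).
Hypothesis HN : hilbert_sqnorm N.
Implicit Types psi phi chi : V.

Let N_ge0 psi : 0 <= N psi. Proof. exact: sqn_ge0 HN psi. Qed.
Let N_eq0 psi : N psi = 0 -> psi = 0. Proof. exact: sqn_eq0 HN psi. Qed.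
Let NZ a psi : N (a *: psi) = cmod a ^+ 2 * N psi.
Proof. exact: sqnZ HN a psi. Qed.
Let N_young (s : R) psi phi : 0 < s ->
  N (psi + phi) <= (1 + s) * N psi + (1 + s^-1) * N phi.
Proof. exact: sqn_young HN s psi phi. Qed.

Lemma sqn0 : N 0 = 0.
Proof. by rewrite -(scale0r 0) NZ cmod0 expr0n mul0r. Qed.

Lemma sqnN psi : N (- psi) = N psi.
Proof. by rewrite -scaleN1r NZ cmodN cmod1 expr1n mul1r. Qed.

Lemma sqn_gt0 psi : psi != 0 -> 0 < N psi.
Proof.
by move=> h; rewrite lt_def N_ge0 andbT; apply: contraNN h => /eqP/N_eq0/eqP.
Qed.

Lemma sqn_add2 psi phi : N (psi + phi) <= 2 * N psi + 2 * N phi.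
Proof. by have := N_young psi phi ltr01; rewrite invr1. Qed.

Lemma sqn_sub2 psi phi : N (psi - phi) <= 2 * N psi + 2 * N phi.
Proof. by rewrite -(sqnN phi) sqn_add2. Qed.

Lemma sqn_subC psi phi : N (psi - phi) = N (phi - psi).
Proof. by rewrite -sqnN opprB. Qed.

Lemma sqn_via chi psi phi :
  N (psi - phi) <= 2 * N (psi - chi) + 2 * N (phi - chi).
Proof. by have := sqn_sub2 (psi - chi) (phi - chi);
  rewrite opprB addrA subrK. Qed.

Lemma geometric_small (k B e : R) : 0 <= k < 1 -> 0 < e ->
  exists n0 : nat, forall n, (n0 <= n)%N -> k ^+ n * B <= e.
Proof.
move=> /andP[k0 k1] e0.
have kn : `|k| < 1 by rewrite ger0_norm.
have := cvg_geometric B kn.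
move=> /cvgrPdist_lt/(_ _ e0)[n0 _ h]; exists n0 => n /h /=.
by rewrite sub0r normrN /geometric /= mulrC => /ltW; apply: le_trans;
  exact: ler_norm.
Qed.

Lemma contraction_solve (A : {linear V -> V}) (k : R) (phi : V) :
  0 <= k < 1 -> (forall psi, N (A psi) <= k * N psi) ->
  exists psi, psi = phi + A psi.
Proof.
move=> /andP[k0 k1] hA.
pose u n := iter n (fun psi => phi + A psi) 0.
have uS n : u n.+1 = phi + A (u n) by [].
(* This weight in Young's inequality gives [(1 + s) * k < 1]; then [B] is the fixed point of [X |->
   (1 + s) * k * X + (1 + s^-1) * N phi], which dominates the recursion for [N (u n)]. *)
pose s := (1 - k) / 2; have s0 : 0 < s by rewrite /s; lra.
have sk : (1 + s) * k < 1 by rewrite /s; nra.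
pose B := (1 + s^-1) * N phi / (1 - (1 + s) * k).
have den0 : 0 < 1 - (1 + s) * k by rewrite subr_gt0.
have sV0 : 0 < s^-1 by rewrite invr_gt0.
have B0 : 0 <= B.
  by apply: divr_ge0 (ltW den0); apply: mulr_ge0 (N_ge0 _); lra.
have uB n : N (u n) <= B.
  elim: n => [|n ih]; first by rewrite sqn0.
  rewrite uS addrC; apply: le_trans (N_young _ _ s0) _.
  have -> : B = (1 + s) * k * B + (1 + s^-1) * N phi.
    by rewrite /B; field; rewrite !lt0r_neq0.
  rewrite lerD2r -mulrA ler_wpM2l //; first lra.
  by apply: le_trans (hA _) _; rewrite ler_wpM2l.
have du n j : N (u (n + j)%N - u n) <= k ^+ n * B.
  elim: n => [|n ih]; first by rewrite subr0 expr0 mul1r.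
  rewrite addSn !uS opprD addrACA subrr add0r -linearB /=.
  by apply: le_trans (hA _) _; rewrite exprS -mulrA ler_wpM2l.
have [|psi hpsi] := sqn_complete HN (x := u).
  move=> e e0; have e2 : 0 < e / 4 by lra.
  have [n0 h0] := geometric_small B (introT andP (conj k0 k1)) e2.
  exists n0 => n m hn hm.
  have d1 := du n0 (n - n0)%N; have d2 := du n0 (m - n0)%N.
  rewrite !subnKC // in d1 d2.
  move: (sqn_via (u n0) (u n) (u m)).
  move: (h0 _ (leqnn n0)) d1 d2; move: (k ^+ n0 * B) => X; lra.
exists psi; apply/eqP; rewrite -subr_eq0; apply: contraT => /sqn_gt0 h.
have e0 : 0 < N (psi - (phi + A psi)) / 8 by lra.
have [n0 h0] := hpsi _ e0.
have h1 := h0 _ (leqnn n0); have h2 := h0 _ (leqnSn n0).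
have h3 : N (u n0.+1 - (phi + A psi)) <= N (u n0 - psi).
  rewrite uS opprD addrACA subrr add0r -linearB.
  apply: le_trans (hA _) _; rewrite -[leRHS]mul1r ler_wpM2r ?N_ge0 //;
    exact: ltW.
have := sqn_via (u n0.+1) psi (phi + A psi).
rewrite [N (psi - u _)]sqn_subC [N (_ + _ - u _)]sqn_subC.
move: h h1 h2 h3; lra.
Qed.

Variable U : {linear V -> V}.

Definition onto_at (l : R[i]) : Prop :=
  forall phi, exists psi, U psi - l *: psi = phi.

Definition below_at (l : R[i]) (K : R) : Prop :=
  forall psi, N psi <= K * N (U psi - l *: psi).

Lemma inverse_at l (K : R) : 0 <= K -> below_at l K -> onto_at l ->
  exists B : {linear V -> V},
  [/\ forall psi, N (B psi) <= K * N psi,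
      forall psi, B (U psi - l *: psi) = psi
    & forall psi, U (B psi) - l *: B psi = psi].
Proof.
move=> K0 hK /choice[B hB].
have inj psi phi : U psi - l *: psi = U phi - l *: phi -> psi = phi.
  move=> h; apply/eqP; rewrite -subr_eq0; apply/eqP/N_eq0/eqP.
  rewrite eq_le N_ge0 andbT; apply: le_trans (hK _) _.
  have -> : U (psi - phi) - l *: (psi - phi) =
      (U psi - l *: psi) - (U phi - l *: phi).
    rewrite linearB scalerBr !opprB [l *: phi - l *: psi]addrC addrACA.
    by rewrite [- U phi + _]addrC.
  by rewrite h subrr sqn0 mulr0.
have Blin : linear B.
  move=> a u v; apply: inj; rewrite hB linearP scalerDr opprD addrACA hB.
  by rewrite scalerA mulrC -scalerA -scalerBr hB.
pose B' : {linear V -> V} :=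
  HB.pack B (GRing.isLinear.Build R[i] V V _ B Blin).
exists B'; split => psi /=.
- by have := hK (B psi); rewrite hB.
- by apply: inj; rewrite hB.
- exact: hB.
Qed.

Definition invertible_at l : Prop := exists (B : {linear V -> V}) (K : R),
  [/\ 0 <= K, forall psi, N (B psi) <= K * N psi,
      forall psi, B (U psi - l *: psi) = psi
    & forall psi, U (B psi) - l *: B psi = psi].

Lemma invertible_of_onto l (K : R) : 0 <= K -> below_at l K -> onto_at l ->
  invertible_at l.
Proof.
by move=> K0 hK hl; have [B [B1 B2 B3]] := inverse_at K0 hK hl; exists B, K.
Qed.

(** With [B] the inverse at [l0], [U - l = (1 - (l - l0) B) (U - l0)], and the first factor is
    inverted by a Neumann series. *)
Lemma onto_perturb l0 l (K : R) : 0 <= K -> below_at l0 K -> onto_at l0 ->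
  cmod (l - l0) ^+ 2 * K < 1 -> onto_at l.
Proof.
move=> K0 hK hl0 small phi; have [B [B1 _ B3]] := inverse_at K0 hK hl0.
have [||chi hchi] := @contraction_solve ((l - l0) \*: B) (cmod (l - l0) ^+ 2 *
  K) phi.
- by rewrite small mulr_ge0 ?sqr_ge0.
- by move=> psi; rewrite /= NZ -mulrA ler_wpM2l ?sqr_ge0.
exists (B chi); have := B3 chi; rewrite [RHS]hchi /= scalerBl => h.
by move/(canRL (subrK _)): h => ->; rewrite addrA !subrK addrK.
Qed.

Hypothesis U_isometry : forall psi, N (U psi) = N psi.
Hypothesis U_onto : forall psi, exists phi, U phi = psi.

Lemma onto_outside l : 1 < cmod l -> onto_at l.
Proof.
move=> l1 phi; have l0 : l != 0 by rewrite -cmod_gt0 (lt_trans _ l1).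
have [||psi hpsi] := @contraction_solve (l^-1 \*: U) (cmod l ^- 2) (- (l^-1 *:
  phi)).
- rewrite invr_ge0 sqr_ge0 /= invf_lt1 ?exprn_gt0 ?cmod_gt0 //.
  by rewrite exprn_egt1 // cmod_ge0.
- by move=> psi; rewrite /= NZ U_isometry cmodV exprVn.
exists psi; rewrite {2}hpsi /= scalerDr scalerN !scalerA divff // !scale1r.
by rewrite opprD opprK addrCA subrr addr0.
Qed.

Lemma below_outside l : 1 < cmod l -> exists2 K : R, 0 <= K & below_at l K.
Proof.
move=> l1; have c1 : 1 < cmod l ^+ 2 by rewrite exprn_egt1 // cmod_ge0.
set c := cmod l ^+ 2 in c1; pose s := (c - 1) / 2.
have s0 : 0 < s by rewrite /s; lra.
have sV : 0 < s^-1 by rewrite invr_gt0.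
exists ((1 + s^-1) / s) => [|psi]; first by rewrite divr_ge0 //; lra.
rewrite -mulrA mulrCA ler_pdivlMl //.
have := N_young (U psi) (- (U psi - l *: psi)) s0.
rewrite sqnN U_isometry opprB addrC subrK NZ -/c.
suff -> : s * N psi = (c - (1 + s)) * N psi by rewrite mulrBl; lra.
by rewrite /s; congr (_ * _); lra.
Qed.

Lemma onto_inside l : cmod l < 1 -> onto_at l.
Proof.
move=> l1; apply: (@onto_perturb 0 l 1) => //.
- by move=> psi; rewrite scale0r subr0 U_isometry mul1r.
- by move=> phi; have [psi <-] := U_onto phi; exists psi; rewrite scale0r subr0.
- by rewrite subr0 mulr1 expr_lt1 // cmod_ge0.
Qed.

Lemma below_inside l : cmod l < 1 -> exists2 K : R, 0 <= K & below_at l K.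
Proof.
move=> l1; have c1 : cmod l ^+ 2 < 1 by rewrite expr_lt1 // cmod_ge0.
have c0 : 0 <= cmod l ^+ 2 by exact: sqr_ge0.
set c := cmod l ^+ 2 in c0 c1; pose s := (1 - c) / 2.
have s0 : 0 < s by rewrite /s; lra.
have sV : 0 < s^-1 by rewrite invr_gt0.
exists ((1 + s^-1) / s) => [|psi]; first by rewrite divr_ge0 //; lra.
rewrite -mulrA mulrCA ler_pdivlMl //.
have := N_young (l *: psi) (U psi - l *: psi) s0.
rewrite addrC subrK U_isometry NZ -/c => h.
have p0 := N_ge0 psi.
have : s * N psi <= (1 - (1 + s) * c) * N psi.
  by rewrite ler_wpM2r // /s; have := sqr_ge0 (1 - c); lra.
rewrite !mulrBl mul1r; move: h; rewrite mulrA; lra.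
Qed.

Lemma invertible_off_circle l : cmod l != 1 -> invertible_at l.
Proof.
rewrite neq_lt => /orP[h|h].
  have [K K0 hK] := below_inside h;
    exact: invertible_of_onto K0 hK (onto_inside h).
have [K K0 hK] := below_outside h;
  exact: invertible_of_onto K0 hK (onto_outside h).
Qed.

(* Surjectivity at a point of the circle is inherited from t * l with t > 1:
   the lower bound survives the move, and one Neumann series leads back. *)
Lemma invertible_of_below l (K : R) : 0 <= K -> below_at l K -> invertible_at l.
Proof.
move=> K0 hK; have [l1|/invertible_off_circle//] := eqVneq (cmod l) 1.
apply: (invertible_of_onto K0 hK).
(* The distance [d] is chosen so that [d ^+ 2 * (4 * K) < 1]. This serves twice: it keeps a lower
   bound at [m], with constant [4 * K], and it makes the Neumann series from [m] back to [l]
   converge. *)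
pose L := 4 * K + 1; pose d := Num.min 1 ((2 * L)^-1).
have L0 : 0 < L by rewrite /L; lra.
have d0 : 0 < d by rewrite lt_min ltr01 invr_gt0 /=; lra.
have d1 : d <= 1 by rewrite ge_min lexx.
have dL : d * (2 * L) <= 1.
  by rewrite -ler_pdivlMr ?mul1r ?ge_min ?lexx ?orbT //; lra.
have d2L : d ^+ 2 * L < 1 by nra.
have d2K : d ^+ 2 * (4 * K) < 1.
  by apply: le_lt_trans d2L; rewrite ler_wpM2l ?sqr_ge0 // /L; lra.
pose m := (1 + d)%:C * l.
have lm : cmod (l - m) = d.
  have -> : l - m = - (d%:C * l).
    by rewrite /m rmorphD rmorph1 mulrDl mul1r opprD addrA subrr add0r.
  by rewrite cmodN cmodM cmodR l1 mulr1 gtr0_norm.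
have m1 : 1 < cmod m by rewrite /m cmodM cmodR l1 mulr1 gtr0_norm; lra.
apply: (@onto_perturb m l (4 * K)) => //; first lra.
- move=> psi.
  have h1 := sqn_add2 (U psi - m *: psi) (- ((l - m) *: psi)).
  rewrite sqnN NZ lm scalerBl opprB addrA subrK in h1.
  have := hK psi => h2.
  have p0 := N_ge0 psi.
  have h3 : K * N (U psi - l *: psi) <=
    K * (2 * N (U psi - m *: psi) + 2 * (d ^+ 2 * N psi)) by rewrite ler_wpM2l.
  have h4 : (d ^+ 2 * (4 * K)) * N psi <= 1 * N psi by rewrite ler_wpM2r // ltW.
  move: h1 h2 h3 h4; rewrite mul1r; lra.
- exact: onto_outside.
- by rewrite lm.
Qed.

End SquareNormedSpace.

(** * Lower bounds off finitely many coordinates *)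

Section Fredholm.
Variables (R : realType) (V : lmodType R[i]) (N : V -> R).
Hypothesis HN : hilbert_sqnorm N.
Variables (I : eqType) (coord : I -> {scalar V}).
Hypothesis coord_le_N : forall z psi, cmod (coord z psi) ^+ 2 <= N psi.
Implicit Types (psi phi : V) (s : seq I) (z : I).

Let N_ge0 psi : 0 <= N psi. Proof. exact: sqn_ge0 HN psi. Qed.
Let N_eq0 psi : N psi = 0 -> psi = 0. Proof. exact: sqn_eq0 HN psi. Qed.
Let NZ (a : R[i]) psi : N (a *: psi) = cmod a ^+ 2 * N psi.
Proof. exact: sqnZ HN a psi. Qed.

Definition vanish s psi : Prop := forall z, z \in s -> coord z psi = 0.

(** A lower bound on a closed subspace of finite codimension: for bounded [T] this stands for the
    semi-Fredholm property, finite-dimensional kernel and closed range. *)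
Definition below_on (T : V -> V) s (K : R) : Prop :=
  forall psi, vanish s psi -> N psi <= K * N (T psi).

Section Kernel.
Variables (T : {linear V -> V}) (C : R).
Hypothesis C_ge0 : 0 <= C.
Hypothesis T_bounded : forall psi, N (T psi) <= C * N psi.

(* Vectors violating the bound more and more, normalized to have coordinate 1
   at z, form a Cauchy sequence since their differences vanish at z; the limit
   is a kernel vector. *)
Lemma below_step s z (K : R) : 0 <= K -> below_on T (z :: s) K ->
  (forall psi, vanish s psi -> T psi = 0 -> psi = 0) ->
  exists2 K' : R, 0 <= K' & below_on T s K'.
Proof.
move=> K0 hK inj; apply: contrapT => nK.
(* Since [M >= K], a violating vector cannot have coordinate 0 at [z] and can be normalized there.
   Since [M >= 8 * K], the term [4 * K * N (T (u n))] is at most half of [N (u n)], so that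
   [N (u n)] stays below [A] and [N (T (u n))] tends to 0. *)
pose M := 8 * K + 1; have M0 : 0 < M by rewrite /M; lra.
have bad (n : nat) : exists phi, [/\ vanish s phi, coord z phi = 1 &
    (M + n%:R) * N (T phi) < N phi].
  have n0 : 0 <= n%:R :> R by [].
  apply: contrapT => nphi; apply: nK; exists (M + n%:R) => [|psi hs].
    by rewrite addr_ge0 // ltW.
  rewrite leNgt; apply/negP => hlt; apply: nphi.
  have [zpsi|zpsi] := eqVneq (coord z psi) 0.
    have /hK h : vanish (z :: s) psi.
      by move=> y; rewrite inE => /orP[/eqP->//|/hs].
    have : K * N (T psi) <= (M + n%:R) * N (T psi).
      by rewrite ler_wpM2r ?N_ge0 // /M; lra.
    lra.
  exists ((coord z psi)^-1 *: psi); split.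
  - by move=> y /hs; rewrite linearZ /= => ->; rewrite mulr0.
  - by rewrite linearZ /= mulVf.
  - rewrite linearZ !NZ mulrCA ltr_pM2l // exprn_gt0 // cmodV invr_gt0.
    by rewrite cmod_gt0.
have [u hu] := choice bad.
have tn n : N (T (u n)) * (M + n%:R) <= N (u n).
  by have [_ _ /ltW] := hu n; rewrite mulrC.
have dn n m : N (u n - u m) <= 2 * K * N (T (u n)) + 2 * K * N (T (u m)).
  have hv : vanish (z :: s) (u n - u m).
    have [hn zn _] := hu n; have [hm zm _] := hu m.
    move=> y; rewrite inE linearB => /orP[/eqP->|ys];
      first by rewrite zn zm subrr.
    by rewrite hn // hm // subrr.
  apply: le_trans (hK _ hv) _; rewrite linearB.
  have := ler_wpM2l K0 (sqn_sub2 HN (T (u n)) (T (u m))); lra.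
pose A := 4 * N (u 0%N) + 8 * K * N (T (u 0%N)).
have A0 : 0 <= A by rewrite addr_ge0 // mulr_ge0 ?N_ge0 // mulr_ge0.
have uA n : N (u n) <= A.
  have h1 := sqn_add2 HN (u n - u 0%N) (u 0%N); rewrite subrK in h1.
  have h2 := dn n 0%N.
  have h3 : N (T (u n)) * (8 * K) <= N (T (u n)) * (M + n%:R).
    by rewrite ler_wpM2l ?N_ge0 // /M; have : 0 <= n%:R :> R by []; lra.
  have h4 := tn n; rewrite /A; lra.
have tsmall e : 0 < e -> exists n0 : nat, forall n, (n0 <= n)%N
  -> N (T (u n)) <= e.
  move=> e0; exists (Num.truncn (A / e)).+1 => n hn.
  have n0 : A / e < n%:R.
    by apply: (lt_le_trans (truncnS_gt _)); rewrite ler_nat.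
  rewrite ltr_pdivrMr // in n0.
  have p : 0 < M + n%:R by rewrite ltr_pwDl.
  rewrite -(ler_pM2r p); apply: le_trans (tn n) _; apply: le_trans (uA n) _.
  by rewrite mulrDr; have := mulr_gt0 e0 M0; rewrite mulrC in n0; lra.
have [|phi hphi] := sqn_complete HN (x := u).
  move=> e e0; have p : 0 < 4 * K + 1 by lra.
  have [n0 h0] := tsmall (e / (4 * K + 1)) (divr_gt0 e0 p).
  exists n0 => n m /h0 hn /h0 hm; apply: le_trans (dn n m) _.
  rewrite ler_pdivlMr // in hn; rewrite ler_pdivlMr // in hm.
  have := N_ge0 (T (u n)); have := N_ge0 (T (u m)); lra.
have lim y c : (forall n, coord y (u n) = c) -> coord y phi = c.
  move=> hc; apply/eqP; rewrite eq_sym -subr_eq0; apply: contraT => ne.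
  have e0 : 0 < cmod (c - coord y phi) ^+ 2 / 2.
    by rewrite divr_gt0 // exprn_gt0 // cmod_gt0.
  have [n0 /(_ _ (leqnn n0)) h] := hphi _ e0.
  have := coord_le_N y (u n0 - phi); rewrite linearB hc; lra.
have phi1 : coord z phi = 1 by apply: lim => n; have [] := hu n.
have phis : vanish s phi.
  by move=> y ys; apply: lim => n; have [hn _ _] := hu n; exact: hn.
have Tphi : T phi = 0.
  apply/eqP; apply: contraT => /(sqn_gt0 HN) h.
  have p : 0 < C + 1 by rewrite ltr_wpDl.
  have e0 : 0 < N (T phi) / (8 * (C + 1)) by rewrite divr_gt0 // mulr_gt0.
  have [n1 h1] := hphi _ e0; have [n2 h2] := tsmall _ e0.
  have {}h1 := h1 _ (leq_maxl n1 n2); have {}h2 := h2 _ (leq_maxr n1 n2).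
  have h3 := sqn_sub2 HN (T (u (maxn n1 n2))) (T (u (maxn n1 n2) - phi)).
  rewrite linearB subKr in h3.
  have h4 := T_bounded (u (maxn n1 n2) - phi).
  rewrite linearB in h4.
  rewrite ler_pdivlMr ?mulr_gt0 // in h1;
    rewrite ler_pdivlMr ?mulr_gt0 // in h2.
  have q1 := N_ge0 (u (maxn n1 n2) - phi).
  have q2 := mulr_ge0 C_ge0 (N_ge0 (T (u (maxn n1 n2)))).
  have q3 := N_ge0 (T (u (maxn n1 n2))).
  lra.
have /eqP := phi1; rewrite (inj _ phis Tphi) linear0 eq_sym.
by rewrite oner_eq0.
Qed.

Lemma dual_kernel s0 (K0 : R) : 0 <= K0 -> below_on T s0 K0 ->
  exists s (K : R) (e : I -> V), [/\ uniq s, 0 <= K, below_on T s K &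
    forall z, z \in s -> T (e z) = 0 /\
      forall z', z' \in s -> coord z' (e z) = (z' == z)%:R].
Proof.
move: {2}(size s0) (leqnn (size s0)) => n.
elim: n s0 K0 => [|n ih] s0 K0 sn K0ge hK.
  move: sn hK; rewrite leqn0 size_eq0 => /eqP -> hK.
  by exists [::], K0, (fun=> 0).
have [all_dual|] := pselect (forall z, z \in s0 -> exists e, T e = 0 /\
    forall z', z' \in s0 -> coord z' e = (z' == z)%:R).
  have /choice[e he] : forall z, exists e, z \in s0 -> T e = 0 /\
      forall z', z' \in s0 -> coord z' e = (z' == z)%:R.
    move=> z; have [zs|zs] := boolP (z \in s0); last by exists 0.
    by have [e he] := all_dual z zs; exists e.
  exists (undup s0), K0, e; split => //; first exact: undup_uniq.
    by move=> psi hv; apply: hK => z; rewrite -mem_undup; exact: hv.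
  move=> z; rewrite mem_undup => /he[h1 h2]; split=> // z'.
  by rewrite mem_undup; exact: h2.
move=> /existsNP[z /not_implyP[zs nz]].
pose s1 := [seq y <- s0 | y != z].
have hsub psi : vanish (z :: s1) psi -> vanish s0 psi.
  move=> hv y ys; apply: hv; rewrite inE mem_filter ys andbT.
  by case: eqP.
have [||K1 K1ge hK1] := @below_step s1 z K0 K0ge.
- by move=> psi /hsub; exact: hK.
- move=> psi hv hT; have [z0|zn0] := eqVneq (coord z psi) 0.
    apply/N_eq0/eqP; rewrite eq_le N_ge0 andbT.
    apply: le_trans (hK _ _) _; last by rewrite hT (sqn0 HN) mulr0.
    apply: hsub => y; rewrite inE => /orP[/eqP->//|]; exact: hv.
  exfalso; apply: nz; exists ((coord z psi)^-1 *: psi); split.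
    by rewrite linearZ_LR hT scaler0.
  move=> y ys; rewrite linearZ /=; have [->|yz] := eqVneq y z.
    by rewrite mulVf.
  have ys1 : y \in s1 by rewrite mem_filter yz.
  by rewrite (hv _ ys1) mulr0.
apply: (ih s1 K1) => //.
rewrite -ltnS; apply: leq_trans sn.
rewrite size_filter -(count_predC (pred1 z) s0) -[X in (X < _)%N]add0n
  ltn_add2r.
by rewrite -has_count has_pred1.
Qed.

Lemma kernel_decomposition s (e : I -> V) psi : uniq s ->
  (forall z, z \in s -> T (e z) = 0 /\
      forall z', z' \in s -> coord z' (e z) = (z' == z)%:R) ->
  let k := \sum_(z <- s) coord z psi *: e z in
  T k = 0 /\ vanish s (psi - k).
Proof.
move=> us he /=; split.
  by rewrite linear_sum big_seq big1 // => z /he[h _];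
    rewrite linearZ_LR h scaler0.
move=> z zs; rewrite linearB linear_sum (bigD1_seq z) //= linearZ /=.
rewrite (he z zs).2 // eqxx mulr1 big_seq_cond big1 ?addr0 ?subrr // => y.
move=> /andP[ys yz]; rewrite linearZ /= (he y ys).2 // eq_sym (negbTE yz).
exact: mulr0.
Qed.

End Kernel.

Section DiscreteSpectrum.
Variable U : {linear V -> V}.
Hypothesis U_isometry : forall psi, N (U psi) = N psi.
Hypothesis U_onto : forall psi, exists phi, U phi = psi.

(* N (psi + a *: e) is invariant under a |-> (l0 / l) * a because U is an
   isometry, and its part linear in a is additive, so this part vanishes. *)
Lemma eigenvectors_orthogonal (l l0 : R[i]) psi e :
  cmod l = 1 -> cmod l0 = 1 -> l != l0 -> U psi = l *: psi -> U e = l0 *: e ->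
  N (psi + e) = N psi + N e.
Proof.
move=> l1 l01 ll0 Upsi Ue.
have ln : l != 0 by rewrite -cmod_eq0 l1 oner_eq0.
pose w := l0 / l.
have w1 : cmod w = 1 by rewrite cmodM cmodV l1 l01 invr1 mulr1.
have rot a : N (psi + (w * a) *: e) = N (psi + a *: e).
  rewrite -(U_isometry (psi + a *: e)) linearD linearZ Upsi Ue.
  have -> : l *: psi + a *: (l0 *: e) = l *: (psi + (w * a) *: e).
    by rewrite scalerDr !scalerA /w mulrA mulrCA divff // mulr1 mulrC.
  by rewrite NZ l1 expr1n mul1r.
have wn : 1 - w != 0.
  by rewrite subr_eq0 eq_sym /w -subr_eq0 -(divff ln) -mulrBl mulf_neq0
    ?invr_eq0 // subr_eq0 eq_sym.
(* The fixed point of [a = 1 + w * a]. In [sqn_quad] for [psi], [e] and [(w * a) *: e] the sums of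
   the last two become [a *: e], and by [rot] and [cmod w = 1] these terms cancel against those with
   [w * a]. *)
pose a := (1 - w)^-1.
have aE : 1 + w * a = a by rewrite /a; field.
have := sqn_quad HN psi (1 *: e) ((w * a) *: e).
rewrite -addrA -!scalerDl aE rot scale1r !NZ cmodM w1 mul1r.
lra.
Qed.

Variables (l0 : R[i]) (s0 : seq I) (K0 : R).
Hypothesis l0_unit : cmod l0 = 1.
Hypothesis K0_ge0 : 0 <= K0.

Let T (l : R[i]) : {linear V -> V} := U \- (l \*: idfun).

Let TE l psi : T l psi = U psi - l *: psi. Proof. by []. Qed.

Let T_bounded l psi : N (T l psi) <= (2 + 2 * cmod l ^+ 2) * N psi.
Proof.
rewrite TE; have := sqn_sub2 HN (U psi) (l *: psi).
by rewrite U_isometry NZ; lra.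
Qed.

Let T_bound_ge0 (l : R[i]) : 0 <= 2 + 2 * cmod l ^+ 2.
Proof. by rewrite addr_ge0 // mulr_ge0 // sqr_ge0. Qed.

Hypothesis below_l0 : below_on (T l0) s0 K0.

Lemma kernel_finite_dim : exists (n : nat) (v : 'I_n -> V), forall psi,
  U psi = l0 *: psi -> exists c : 'I_n -> R[i], psi = \sum_i c i *: v i.
Proof.
have [s [K [e [us K_ge0 hK he]]]]
  := dual_kernel (T_bound_ge0 l0) (T_bounded l0) K0_ge0 below_l0.
exists (size s), (fun i => e (tnth (in_tuple s) i)) => psi Upsi.
exists (fun i => coord (tnth (in_tuple s) i) psi).
have [k0 kv] := kernel_decomposition psi us he.
rewrite -(big_tuple _ _ (in_tuple s) xpredT (fun z => coord z psi *: e z)) /=.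
apply/eqP; rewrite -subr_eq0; apply/eqP/N_eq0/eqP; rewrite eq_le N_ge0 andbT.
apply: le_trans (hK _ kv) _.
by rewrite linearB k0 subr0 TE Upsi subrr (sqn0 HN) mulr0.
Qed.

(** Every coordinate left over by [dual_kernel] comes with a nonzero kernel vector; if none is left,
    the bound is unconditional. *)
Lemma below_or_eigenvalue l (K : R) : 0 <= K -> below_on (T l) s0 K ->
  (exists2 K' : R, 0 <= K' & forall psi, N psi <= K' * N (U psi - l *: psi)) \/
  exists2 psi, psi != 0 & U psi = l *: psi.
Proof.
move=> K_ge0 /(dual_kernel (T_bound_ge0 l) (T_bounded l) K_ge0).
move=> [[|z s] [K' [e [us K'_ge0 hK' he]]]].
  by left; exists K' => // psi; apply: hK'.
have [Te ez] := he z (mem_head _ _); right; exists (e z).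
  have := ez z (mem_head _ _); rewrite eqxx => h.
  by apply: contra_eq_neq h => ->; rewrite linear0 eq_sym oner_eq0.
by apply/eqP; rewrite -subr_eq0 -TE Te.
Qed.

(** The bound on [s0] survives near [l0], so the only alternative to invertibility on the circle is
    an eigenvector [psi]. With [k] the vector of the kernel at [l0] that has the same coordinates on
    [s], orthogonality gives [N psi <= N (psi - k) <= K * cmod (l - l0) ^+ 2 * N psi], which is
    impossible close to [l0]. *)
Lemma punctured_neighborhood_invertible : exists2 r : R, 0 < r &
  forall l, l != l0 -> cmod (l - l0) < r -> invertible_at N U l.
Proof.
have [s [K [e [us K_ge0 hK he]]]]
  := dual_kernel (T_bound_ge0 l0) (T_bounded l0) K0_ge0 below_l0.
have K00 := K0_ge0.
(* Large enough for both uses: [4 * K0] for the surviving bound, [K] for the final contradiction. As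
   [B >= 1], the radius is at most 1 and squaring the distance only helps. *)
pose B := 4 * K0 + K + 1.
have B0 : 1 <= B by rewrite /B; lra.
exists B^-1 => [|l ll0 lr]; first by rewrite invr_gt0; lra.
have [l1|] := eqVneq (cmod l) 1; last exact: invertible_off_circle.
have small : cmod (l - l0) ^+ 2 * B < 1.
  have h : cmod (l - l0) * B < 1 by rewrite -ltr_pdivlMr ?div1r //; lra.
  have := cmod_ge0 (l - l0); nra.
have below_l : below_on (T l) s0 (4 * K0).
  move=> psi hv; have h1 := below_l0 hv.
  have h2 := sqn_add2 HN (T l psi) ((l - l0) *: psi).
  rewrite !TE in h1 h2 *.
  rewrite NZ scalerBl addrA subrK in h2.
  have h3 := ler_wpM2l K0_ge0 h2.
  have h4 : cmod (l - l0) ^+ 2 * (4 * K0) * N psi <= 1 * N psi.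
    rewrite ler_wpM2r //; apply: le_trans (ltW small).
    by rewrite ler_wpM2l ?sqr_ge0 // /B; lra.
  lra.
have [[K' K'_ge0 hK']|[psi psi0 Upsi]]
  := below_or_eigenvalue (mulr_ge0 (ler0n _ 4) K0_ge0) below_l.
  exact: invertible_of_below hK'.
have [k0 kv] := kernel_decomposition psi us he.
set k := \sum_(z <- s) _ in k0 kv.
have h1 := hK _ kv; rewrite linearB k0 subr0 TE Upsi -scalerBl NZ in h1.
have Uk : U (- k) = l0 *: (- k).
  by rewrite linearN scalerN; congr (- _); apply/eqP; rewrite -subr_eq0 -TE k0.
have h2 := eigenvectors_orthogonal l1 l0_unit ll0 Upsi Uk.
have h3 := sqn_gt0 HN psi0.
have h4 : cmod (l - l0) ^+ 2 * K * N psi < 1 * N psi.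
  rewrite ltr_pM2r //; apply: le_lt_trans small.
  by rewrite ler_wpM2l ?sqr_ge0 // /B; lra.
have h5 := N_ge0 (- k).
exfalso; lra.
Qed.

End DiscreteSpectrum.
End Fredholm.

(** * The walk on square-summable functions *)

Section SquaredNorm.
Variable R : realType.
Implicit Types (v w : 'cV[R[i]]_2) (psi phi u : ell2 R).

Lemma ord2E (i : 'I_2) : i = 0 \/ i = 1.
Proof. by case: i => [[|[|//]] hi]; [left|right]; apply/val_inj. Qed.

Lemma sqnorm2_sum v : sqnorm2 v = cmod (v 0 0) ^+ 2 + cmod (v 1 0) ^+ 2.
Proof.
rewrite /sqnorm2 !big_ord_recl big_ord0 addr0.
by have -> : lift ord0 ord0 = 1 :> 'I_2 by exact/val_inj.
Qed.

Lemma cmod_le_sqnorm2 v (i : 'I_2) : cmod (v i 0) ^+ 2 <= sqnorm2 v.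
Proof.
by rewrite sqnorm2_sum; case: (ord2E i) => ->; rewrite ?lerDl ?lerDr sqr_ge0.
Qed.

Lemma sqnorm2_eq0 v : (sqnorm2 v == 0) = (v == 0).
Proof.
apply/eqP/eqP => [h|->]; last first.
  by rewrite sqnorm2_sum !mxE cmod0 expr0n addr0.
apply/colP => i; rewrite mxE; apply/eqP; rewrite -cmod_eq0 -sqrf_eq0.
by rewrite eq_le sqr_ge0 andbT -h cmod_le_sqnorm2.
Qed.

Lemma sqnorm2_0 : sqnorm2 (0 : 'cV[R[i]]_2) = 0.
Proof. by apply/eqP; rewrite sqnorm2_eq0. Qed.

Lemma sqnorm2N v : sqnorm2 (- v) = sqnorm2 v.
Proof. by rewrite !sqnorm2_sum !mxE !cmodN. Qed.

Lemma sqnorm2_young (s : R) v w : 0 < s ->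
  sqnorm2 (v + w) <= (1 + s) * sqnorm2 v + (1 + s^-1) * sqnorm2 w.
Proof.
move=> s0.
have young (a b : R[i]) :
    cmod (a + b) ^+ 2 <= (1 + s) * cmod a ^+ 2 + (1 + s^-1) * cmod b ^+ 2.
  apply: (@le_trans _ _ ((cmod a + cmod b) ^+ 2)).
    by rewrite ler_sqr ?nnegrE ?addr_ge0 ?cmod_ge0 // cmod_triangle.
  set x := cmod a; set y := cmod b.
  rewrite -subr_ge0.
  have -> : (1 + s) * x ^+ 2 + (1 + s^-1) * y ^+ 2 - (x + y) ^+ 2 =
     s^-1 * (s * x - y) ^+ 2 by field; rewrite gt_eqF.
  by rewrite mulr_ge0 ?sqr_ge0 // invr_ge0 ltW.
rewrite !sqnorm2_sum !mxE !mulrDr.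
apply: le_trans (lerD (young _ _) (young _ _)) _.
by rewrite le_eqVlt; apply/orP; left; apply/eqP; ring.
Qed.

Definition N2 psi : R := zsum (fun x => sqnorm2 (psi x)).

Lemma ell2_zsummable psi : zsummable (fun x => sqnorm2 (psi x)).
Proof.
by split=> [x|]; [exact: sqnorm2_ge0|have := ell2P psi; rewrite unfold_in].
Qed.

Lemma ell2_ext psi phi : (forall x, psi x = phi x) -> psi = phi.
Proof. by move=> h; apply/val_inj/funext. Qed.

Lemma ell2D psi phi x : (psi + phi) x = psi x + phi x. Proof. by []. Qed.
Lemma ell2N psi x : (- psi) x = - psi x. Proof. by []. Qed.
Lemma ell2Z (a : R[i]) psi x : (a *: psi) x = a *: psi x. Proof. by []. Qed.
Lemma ell2_0 x : (0 : ell2 R) x = 0. Proof. by []. Qed.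

Lemma N2_ge0 psi : 0 <= N2 psi.
Proof. by apply: zsum_ge0 => x; exact: sqnorm2_ge0. Qed.

Lemma ell2_normE psi : ell2_norm psi = Num.sqrt (N2 psi).
Proof. by []. Qed.

Lemma sqnorm2_le_N2 psi x : sqnorm2 (psi x) <= N2 psi.
Proof.
have := @zsum_seq _ _ [:: x] isT (ell2_zsummable psi).
by rewrite big_seq1.
Qed.

Lemma N2_eq0 psi : N2 psi = 0 -> psi = 0.
Proof.
move=> h; apply: ell2_ext => x; apply/eqP; rewrite -sqnorm2_eq0 eq_le.
by rewrite sqnorm2_ge0 -[leRHS]h sqnorm2_le_N2.
Qed.

Lemma N2_eq psi phi : (forall x, sqnorm2 (psi x) = sqnorm2 (phi x)) ->
  N2 psi = N2 phi.
Proof. by move=> h; congr zsum; apply/funext. Qed.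

Lemma N2Z (a : R[i]) psi : N2 (a *: psi) = cmod a ^+ 2 * N2 psi.
Proof.
rewrite -zsumZ ?sqr_ge0 //; last exact: ell2_zsummable.
by congr zsum; apply/funext => x; rewrite -sqnorm2Z.
Qed.

Lemma N2N psi : N2 (- psi) = N2 psi.
Proof. by apply: N2_eq => x; rewrite sqnorm2N. Qed.

Lemma N2_young (s : R) psi phi : 0 < s ->
  N2 (psi + phi) <= (1 + s) * N2 psi + (1 + s^-1) * N2 phi.
Proof.
move=> s0; have a0 : 0 <= 1 + s by rewrite addr_ge0 // ltW.
have b0 : 0 <= 1 + s^-1 by rewrite addr_ge0 // invr_ge0 ltW.
have hp := zsummableZ a0 (ell2_zsummable psi).
have hq := zsummableZ b0 (ell2_zsummable phi).
rewrite -!zsumZ //; try exact: ell2_zsummable.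
rewrite -zsumD //; apply: zsum_le => [x||x]; first exact: sqnorm2_ge0.
  exact: zsummableD.
exact: sqnorm2_young.
Qed.

Lemma N2_add2 psi phi : N2 (psi + phi) <= 2 * N2 psi + 2 * N2 phi.
Proof. by have := N2_young psi phi ltr01; rewrite invr1. Qed.

Lemma N2_sub2 psi phi : N2 (psi - phi) <= 2 * N2 psi + 2 * N2 phi.
Proof. by rewrite -(N2N phi) N2_add2. Qed.

Lemma sqnorm2_quad (u v w : 'cV[R[i]]_2) :
  sqnorm2 (u + v + w) + (sqnorm2 u + (sqnorm2 v + sqnorm2 w)) =
  sqnorm2 (u + v) + (sqnorm2 (u + w) + sqnorm2 (v + w)).
Proof.
have quad (a b c : R[i]) :
   cmod (a + b + c) ^+ 2 + (cmod a ^+ 2 + (cmod b ^+ 2 + cmod c ^+ 2)) =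
   cmod (a + b) ^+ 2 + (cmod (a + c) ^+ 2 + cmod (b + c) ^+ 2).
  rewrite !cmod_sqr; case: a => a a'; case: b => b b'; case: c => c c' /=.
  ring.
rewrite !sqnorm2_sum !mxE.
have := quad (u 0 0) (v 0 0) (w 0 0); have := quad (u 1 0) (v 1 0) (w 1 0).
lra.
Qed.

Lemma N2_quad psi phi u :
  N2 (psi + phi + u) + (N2 psi + (N2 phi + N2 u)) =
  N2 (psi + phi) + (N2 (psi + u) + N2 (phi + u)).
Proof.
apply: zsum_eq43; try exact: ell2_zsummable.
move=> x; exact: sqnorm2_quad.
Qed.

End SquaredNorm.

Section WalkOperators.
Variable R : realType.
Implicit Types (psi phi : ell2 R) (C : coin R).

Lemma component_zsummable psi (i : 'I_2) :
  zsummable (fun x => cmod (psi x i 0) ^+ 2).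
Proof.
split=> [x|]; first exact: sqr_ge0.
apply: (@summable_dominated _ 1 _ (fun x => sqnorm2 (psi x))).
- by move=> x; exact: sqnorm2_ge0.
- by move=> x; rewrite mul1r cmod_le_sqnorm2.
- exact: (ell2_zsummable psi).2.
Qed.

Lemma N2_components psi : N2 psi =
  zsum (fun x => cmod (psi x 0 0) ^+ 2) + zsum (fun x => cmod (psi x 1 0) ^+ 2).
Proof.
rewrite -zsumD; try exact: component_zsummable.
by congr zsum; apply/funext => x; rewrite sqnorm2_sum.
Qed.

Lemma addz_bij (y : int) : bijective (fun x : int => x + y).
Proof. by exists (fun x => x - y) => x; [exact: addrK|exact: subrK]. Qed.

Lemma shift0E psi x : shift psi x 0 0 = psi (x + 1) 0 0.
Proof. by rewrite mxE. Qed.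

Lemma shift1E psi x : shift psi x 1 0 = psi (x - 1) 1 0.
Proof. by rewrite mxE. Qed.

Lemma N2_shift psi : N2 (shift psi) = N2 psi.
Proof.
rewrite !N2_components; congr (_ + _).
  rewrite -(zsum_bij (addz_bij 1) (component_zsummable psi 0)).2.
  by congr zsum; apply/funext => x; rewrite shift0E.
rewrite -(zsum_bij (addz_bij (-1)) (component_zsummable psi 1)).2.
by congr zsum; apply/funext => x; rewrite shift1E.
Qed.

Lemma coin_opE C psi x : coin_op C psi x = C x *m psi x.
Proof. by []. Qed.

Lemma N2_coin C psi : N2 (coin_op C psi) = N2 psi.
Proof. by apply: N2_eq => x;
  rewrite coin_opE sqnorm2_unitary ?coin_unitary. Qed.

Lemma square_summableP (f : int -> 'cV[R[i]]_2) :
  zsummable (fun x => sqnorm2 (f x)) -> f \in @square_summable R.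
Proof. by move=> [_ h]; rewrite unfold_in. Qed.

Lemma shift_surj psi : exists phi, shift phi = psi.
Proof.
pose f (x : int) : 'cV[R[i]]_2 :=
  \col_(i < 2) if i == 0 then psi (x - 1) 0 0 else psi (x + 1) 1 0.
have fP : f \in @square_summable R.
  apply: square_summableP.
  have -> : (fun x => sqnorm2 (f x)) =
      (fun x => cmod (psi (x - 1) 0 0) ^+ 2 + cmod (psi (x + 1) 1 0) ^+ 2).
    by apply/funext => x; rewrite sqnorm2_sum !mxE.
  apply: zsummableD.
    exact: (zsum_bij (addz_bij (-1)) (component_zsummable psi 0)).1.
  exact: (zsum_bij (addz_bij 1) (component_zsummable psi 1)).1.
exists (Ell2 fP); apply: ell2_ext => x; apply/colP => i.
by case: (ord2E i) => ->; rewrite ?shift0E ?shift1E mxE /= ?addrK ?subrK.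
Qed.

Lemma coin_surj C psi : exists phi, coin_op C phi = psi.
Proof.
pose f (x : int) : 'cV[R[i]]_2 := ((C x) ^t*)%sesqui *m psi x.
have CC x : C x *m ((C x) ^t*)%sesqui = 1%:M by exact/unitarymxP/coin_unitary.
have fP : f \in @square_summable R.
  apply: square_summableP.
  have -> : (fun x => sqnorm2 (f x)) = (fun x => sqnorm2 (psi x)).
    apply/funext => x; rewrite -(sqnorm2_unitary _ (coin_unitary C x)).
    by rewrite mulmxA CC mul1mx.
  exact: ell2_zsummable.
exists (Ell2 fP); apply: ell2_ext => x.
by rewrite coin_opE /= mulmxA CC mul1mx.
Qed.

Lemma mulmx22 (A : 'M[R[i]]_2) (v : 'cV[R[i]]_2) i :
  (A *m v) i 0 = A i 0 * v 0 0 + A i 1 * v 1 0.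
Proof.
rewrite mxE !big_ord_recl big_ord0 addr0.
by have -> : lift ord0 ord0 = 1 :> 'I_2 by exact/val_inj.
Qed.

Lemma step0E C psi x : shift (coin_op C psi) x 0 0 =
  C (x + 1) 0 0 * psi (x + 1) 0 0 + C (x + 1) 0 1 * psi (x + 1) 1 0.
Proof. by rewrite shift0E coin_opE mulmx22. Qed.

Lemma step1E C psi x : shift (coin_op C psi) x 1 0 =
  C (x - 1) 1 0 * psi (x - 1) 0 0 + C (x - 1) 1 1 * psi (x - 1) 1 0.
Proof. by rewrite shift1E coin_opE mulmx22. Qed.

Section Walk.
Variables (A : set int) (C1 C2 : coin R).

Let walk_coin_unitary x : (if x \in A then C1 x else C2 x) \is unitarymx.
Proof. by case: ifP => _; exact: coin_unitary. Qed.

Definition walk_coin : coin R := Coin walk_coin_unitary.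

(** The cutoff and its complement select one coin at each site, so the walk is a shift after a
    single pointwise unitary; the later estimates deal with one coin only. *)
Lemma walkE psi : walk A C1 C2 psi = shift (coin_op walk_coin psi).
Proof.
rewrite /walk /=; congr shift; apply: ell2_ext => x.
rewrite !ell2D ell2N coin_opE /=.
case: ifP => _; first by rewrite subrr addr0.
by rewrite subr0 add0r.
Qed.

Lemma N2_walk psi : N2 (walk A C1 C2 psi) = N2 psi.
Proof. by rewrite walkE N2_shift N2_coin. Qed.

Lemma walk_surj psi : exists phi, walk A C1 C2 phi = psi.
Proof.
have [u <-] := shift_surj psi; have [v <-] := coin_surj walk_coin u.
by exists v; rewrite walkE.
Qed.

Lemma walk0E psi x : walk A C1 C2 psi x 0 0 =
  walk_coin (x + 1) 0 0 * psi (x + 1) 0 0 + walk_coin (x + 1) 0 1 * psi (x + 1)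
    1 0.
Proof. by rewrite walkE step0E. Qed.

Lemma walk1E psi x : walk A C1 C2 psi x 1 0 =
  walk_coin (x - 1) 1 0 * psi (x - 1) 0 0 + walk_coin (x - 1) 1 1 * psi (x - 1)
    1 0.
Proof. by rewrite walkE step1E. Qed.

End Walk.
End WalkOperators.

(** * Completeness of the square-summable functions *)

Section Completeness.
Variable R : realType.

Lemma real_cauchy_sqr (a : nat -> R) :
  (forall e : R, 0 < e -> exists n0 : nat, forall n m, (n0 <= n)%N
    -> (n0 <= m)%N ->
    (a n - a m) ^+ 2 <= e) ->
  exists l, forall e : R, 0 < e -> exists n0 : nat, forall n, (n0 <= n)%N ->
    (a n - l) ^+ 2 <= e.
Proof.
move=> ha.
have sq (e x : R) : 0 < e -> x ^+ 2 <= (e / 2) ^+ 2 -> `|x| < e.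
  move=> e0 h; apply: (@le_lt_trans _ _ (e / 2)); last by lra.
  by rewrite -ler_sqr ?nnegrE ?real_normK ?num_real // divr_ge0 // ltW.
have /cauchy_cvgP/cvg_ex [l hl] : cauchy (a @ \oo).
  apply/cauchy_exP => e e0.
  have [n0 hn0] := ha ((e / 2) ^+ 2) (exprn_gt0 _ (divr_gt0 e0 (ltr0n _ 2))).
  exists (a n0); exists n0 => // n /= hn.
  by rewrite /ball /=; apply: sq => //; exact: hn0.
exists l => e e0.
have se : 0 < Num.sqrt e by rewrite sqrtr_gt0.
have [n0 _ hn0] := (cvgrPdist_lt _ _).1 hl _ se.
exists n0 => n hn; have := hn0 n hn; rewrite /= distrC => h.
rewrite -(sqr_sqrtr (ltW e0)) -[leLHS]real_normK ?num_real //.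
rewrite ler_sqr ?nnegrE ?normr_ge0 ?(ltW se) //. exact: ltW.
Qed.

Lemma complex_cauchy_sqr (a : nat -> R[i]) :
  (forall e : R, 0 < e -> exists n0 : nat, forall n m, (n0 <= n)%N
    -> (n0 <= m)%N ->
    cmod (a n - a m) ^+ 2 <= e) ->
  exists l, forall e : R, 0 < e -> exists n0 : nat, forall n, (n0 <= n)%N ->
    cmod (a n - l) ^+ 2 <= e.
Proof.
move=> ha.
have sub (z w : R[i]) : cmod (z - w) ^+ 2 =
    (complex.Re z - complex.Re w) ^+ 2 + (complex.Im z - complex.Im w) ^+ 2.
  by rewrite cmod_sqr; case: z => ? ?; case: w.
have [|l hl] := @real_cauchy_sqr (fun n => complex.Re (a n)).
  move=> e /ha[n0 h]; exists n0 => n m hn hm; apply: le_trans (h n m hn hm).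
  by rewrite sub lerDl sqr_ge0.
have [|l' hl'] := @real_cauchy_sqr (fun n => complex.Im (a n)).
  move=> e /ha[n0 h]; exists n0 => n m hn hm; apply: le_trans (h n m hn hm).
  by rewrite sub lerDr sqr_ge0.
exists (l +i* l') => e e0; have e2 : 0 < e / 2 by lra.
have [n1 h1] := hl _ e2; have [n2 h2] := hl' _ e2.
exists (maxn n1 n2) => n; rewrite geq_max => /andP[hn1 hn2].
by rewrite sub /= [leRHS]splitr lerD ?h1 ?h2.
Qed.

Lemma sqnorm2_cauchy (a : nat -> 'cV[R[i]]_2) :
  (forall e : R, 0 < e -> exists n0 : nat, forall n m, (n0 <= n)%N
    -> (n0 <= m)%N ->
    sqnorm2 (a n - a m) <= e) ->
  exists l, forall e : R, 0 < e -> exists n0 : nat, forall n, (n0 <= n)%N ->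
    sqnorm2 (a n - l) <= e.
Proof.
move=> ha.
have comp (i : 'I_2) : exists l, forall e : R, 0 < e
  -> exists n0 : nat, forall n,
    (n0 <= n)%N -> cmod (a n i 0 - l) ^+ 2 <= e.
  apply: complex_cauchy_sqr => e /ha[n0 h]; exists n0 => n m hn hm.
  by apply: le_trans (h n m hn hm); have := cmod_le_sqnorm2 (a n - a m) i;
    rewrite !mxE.
have [l0 h0] := comp 0; have [l1 h1] := comp 1.
exists (\col_(i < 2) if i == 0 then l0 else l1) => e e0.
have e2 : 0 < e / 2 by lra.
have [n1 h1'] := h0 _ e2; have [n2 h2'] := h1 _ e2.
exists (maxn n1 n2) => n; rewrite geq_max => /andP[hn1 hn2].
by rewrite sqnorm2_sum !mxE /= [leRHS]splitr lerD ?h1' ?h2'.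
Qed.

Definition N2_cauchy (u : nat -> ell2 R) : Prop :=
  forall e : R, 0 < e -> exists n0 : nat, forall n m, (n0 <= n)%N -> (n0 <= m)%N
    ->
    N2 (u n - u m) <= e.

Definition N2_limit (u : nat -> ell2 R) (psi : ell2 R) : Prop :=
  forall e : R, 0 < e -> exists n0 : nat, forall n, (n0 <= n)%N ->
    N2 (u n - psi) <= e.

Lemma N2_complete (u : nat -> ell2 R) : N2_cauchy u
  -> exists psi, N2_limit u psi.
Proof.
move=> hu.
have pt x : exists l, forall e : R, 0 < e
  -> exists n0 : nat, forall n, (n0 <= n)%N ->
    sqnorm2 (u n x - l) <= e.
  apply: sqnorm2_cauchy => e /hu[n0 h]; exists n0 => n m hn hm.
  exact: le_trans (sqnorm2_le_N2 (u n - u m) x) (h n m hn hm).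
have [l hl] := choice pt.
have unif (s : seq int) e : 0 < e -> exists n0 : nat, forall n, (n0 <= n)%N ->
    \sum_(x <- s) sqnorm2 (u n x - l x) <= e.
  elim: s e => [|x s ih] e e0; first by exists 0%N => n _; rewrite big_nil ltW.
  have e2 : 0 < e / 2 by lra.
  have [n1 h1] := ih _ e2; have [n2 h2] := hl x _ e2.
  exists (maxn n1 n2) => n; rewrite geq_max => /andP[hn1 hn2].
  by rewrite big_cons [leRHS]splitr lerD ?h1 ?h2.
have tail e : 0 < e -> exists n0 : nat, forall n, (n0 <= n)%N ->
    zsummable (fun x => sqnorm2 (u n x - l x)) /\
    zsum (fun x => sqnorm2 (u n x - l x)) <= e.
  move=> e0; have e4 : 0 < e / 4 by lra.
  have [n0 h0] := hu _ e4; exists n0 => n hn.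
  apply: zsum_bound => [x|s us]; first exact: sqnorm2_ge0.
  (* Pointwise convergence is uniform on the finite list [s]. The auxiliary index [m] depends on
     [s], but the resulting bound does not. *)
  have [n1 h1] := unif s _ e4.
  pose m := maxn n0 n1.
  have A : \sum_(x <- s) sqnorm2 (u n x - u m x) <= e / 4.
    apply: le_trans (zsum_seq us (ell2_zsummable (u n - u m))) _.
    by apply: h0 => //; exact: leq_maxl.
  have B := h1 m (leq_maxr _ _).
  apply: (@le_trans _ _ (\sum_(x <- s)
      (2 * sqnorm2 (u n x - u m x) + 2 * sqnorm2 (u m x - l x)))).
    apply: ler_sum => x _.
    have := @sqnorm2_young _ 1 (u n x - u m x) (u m x - l x) ltr01.
    by rewrite invr1 addrA subrK.
  rewrite big_split /= -!mulr_sumr; lra.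
have [n0 /(_ _ (leqnn n0))[hs _]] := tail 1 ltr01.
(* The pointwise limit [l] is not yet known to be square-summable, but [u n0 - l] is; so the limit
   is introduced as [u n0 - d]. *)
pose d := Ell2 (square_summableP hs).
exists (u n0 - d) => e /tail[n1 h1]; exists n1 => n /h1[_ h].
apply: le_trans h; rewrite le_eqVlt; apply/orP; left; apply/eqP.
by congr zsum; apply/funext => x; rewrite !(ell2D, ell2N) /= subKr.
Qed.

End Completeness.

Section EssentialSpectrum.
Variable R : realType.

Lemma ell2_hilbert : @hilbert_sqnorm R (ell2 R) (@N2 R).
Proof.
split; [exact: N2_ge0|exact: N2_eq0|exact: N2Z|exact: N2_young|exact: N2_quad|].
exact: N2_complete.
Qed.

Definition ell2_coord (z : int * 'I_2) (psi : ell2 R) : R[i] := psi z.1 z.2 0.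

Fact ell2_coord_linear z : scalar (ell2_coord z).
Proof. by move=> a u v; rewrite /ell2_coord ell2D ell2Z !mxE. Qed.

HB.instance Definition _ z :=
  GRing.isLinear.Build R[i] (ell2 R) R[i] _ (ell2_coord z) (ell2_coord_linear
    z).

Definition coord_form (z : int * 'I_2) : {scalar (ell2 R)} := ell2_coord z.

Lemma coord_le_N2 z psi : cmod (coord_form z psi) ^+ 2 <= N2 psi.
Proof. exact: le_trans (cmod_le_sqnorm2 _ _) (sqnorm2_le_N2 _ _). Qed.

Variable U : {linear ell2 R -> ell2 R}.

Lemma resolvent_of_invertible l : invertible_at (@N2 R) U l
  -> resolvent_set U l.
Proof.
move=> [B [K [K0 B1 B2 B3]]]; exists B; split=> //; exists (Num.sqrt K) => psi.
by rewrite !ell2_normE -sqrtrM // ler_wsqrtr.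
Qed.

Lemma resolvent_below l : resolvent_set U l ->
  exists2 K : R, 0 <= K & forall psi, N2 psi <= K * N2 (U psi - l *: psi).
Proof.
move=> [B [[K hK] hB _]]; exists (K ^+ 2) => [|psi]; first exact: sqr_ge0.
have := hK (U psi - l *: psi); rewrite hB !ell2_normE => h.
rewrite -[leLHS](sqr_sqrtr (N2_ge0 psi)).
rewrite -[X in _ * X](sqr_sqrtr (N2_ge0 _)) -exprMn ler_sqr ?nnegrE ?sqrtr_ge0
  //.
exact: le_trans (sqrtr_ge0 _) h.
Qed.

Hypothesis U_isometry : forall psi, N2 (U psi) = N2 psi.
Hypothesis U_onto : forall psi, exists phi, U phi = psi.

Lemma spectrum_circle l : spectrum U l -> cmod l = 1.
Proof.
move=> sl; apply/eqP; apply: contraT => /(invertible_off_circle ell2_hilbert) h.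
by exfalso; apply: sl; apply: resolvent_of_invertible; exact: h.
Qed.

Lemma not_essential l0 (s : seq (int * 'I_2)) (K : R) : 0 <= K ->
  below_on (@N2 R) coord_form (fun psi => U psi - l0 *: psi) s K ->
  ~ essential_spectrum U l0.
Proof.
move=> K0 hK [sl nd]; apply: nd.
have l1 := spectrum_circle sl.
split.
- have [r r0 hr] := punctured_neighborhood_invertible ell2_hilbert coord_le_N2
  U_isometry U_onto l1 K0 hK.
  split; first exact/mem_set.
  exists (ball (l0 : R[i]^o) (r%:C)).
    by apply: nbhsx_ballx; rewrite (ltcR 0).
  apply/seteqP; split=> [l [lr sl']|_ ->]; last first.
    by split => //; apply: ballxx; rewrite (ltcR 0).
  have [//|ll0] := eqVneq l l0.
  exfalso; apply: sl'; apply: resolvent_of_invertible; apply: hr => //.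
  by move: lr; rewrite -ball_normE /= -cmod_normr ltcR -cmodN opprB.
- have [[K' K'0 hK']|[psi psi0 Upsi]] :=
    below_or_eigenvalue ell2_hilbert coord_le_N2 U_isometry K0 hK;
      last by exists psi.
  exfalso; apply: sl; apply: resolvent_of_invertible.
  apply: (invertible_of_below ell2_hilbert (U := U) U_isometry U_onto K'0).
  exact: hK'.
- have [n [v h]] := kernel_finite_dim ell2_hilbert coord_le_N2 U_isometry K0 hK.
  by exists n, v.
Qed.

End EssentialSpectrum.

(** * The free walk *)

Section FreeWalk.
Variable R : realType.
Implicit Types (psi phi : ell2 R) (C : coin R).

Lemma ell2_entryD psi phi x i : (psi + phi) x i 0 = psi x i 0 + phi x i 0.
Proof. by rewrite ell2D mxE. Qed.

Lemma ell2_entryN psi x i : (- psi) x i 0 = - psi x i 0.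
Proof. by rewrite ell2N mxE. Qed.

Lemma ell2_entryZ (a : R[i]) psi x i : (a *: psi) x i 0 = a * psi x i 0.
Proof. by rewrite ell2Z mxE. Qed.

Lemma entry_eq psi phi : (forall x, psi x 0 0 = phi x 0 0) ->
  (forall x, psi x 1 0 = phi x 1 0) -> psi = phi.
Proof.
move=> h0 h1; apply: ell2_ext => x; apply/colP => i.
by case: (ord2E i) => ->; rewrite ?h0 ?h1.
Qed.

Lemma N2_step C psi : N2 (shift (coin_op C psi)) = N2 psi.
Proof. by rewrite N2_shift N2_coin. Qed.

Fact translate_subproof (y : int) psi :
  (fun x => psi (x + y)) \in @square_summable R.
Proof.
apply: square_summableP; exact: (zsum_bij (addz_bij y) (ell2_zsummable psi)).1.
Qed.

Definition translate (y : int) psi : ell2 R := Ell2 (translate_subproof y psi).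

Lemma N2_translate y psi : N2 (translate y psi) = N2 psi.
Proof. exact: (zsum_bij (addz_bij y) (ell2_zsummable psi)).2. Qed.

Section ConstantCoin.
Variables (p q alpha beta gamma : R).
Hypothesis pq : p ^+ 2 + q ^+ 2 = 1.

Let C0 := coin0_mx p q alpha beta gamma.

Lemma coin0_00 : C0 0 0 = p%:C * expi alpha. Proof. by rewrite mxE. Qed.
Lemma coin0_01 : C0 0 1 = q%:C * expi beta. Proof. by rewrite mxE. Qed.
Lemma coin0_10 : C0 1 0 = - (q%:C * expi (- (beta - gamma))).
Proof. by rewrite mxE. Qed.
Lemma coin0_11 : C0 1 1 = p%:C * expi (- (alpha - gamma)).
Proof. by rewrite mxE. Qed.

Lemma coin0_det : C0 0 0 * C0 1 1 - C0 0 1 * C0 1 0 = expi gamma.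
Proof.
rewrite coin0_00 coin0_01 coin0_10 coin0_11 mulrN opprK.
rewrite [X in X + _]mulrACA [X in _ + X]mulrACA -!expiD.
have -> : alpha + - (alpha - gamma) = gamma by ring.
have -> : beta + - (beta - gamma) = gamma by ring.
by rewrite -mulrDl -!expr2 -!rmorphXn -rmorphD pq mul1r.
Qed.

Fact coin0_unitary : C0 \is unitarymx.
Proof.
apply/unitarymxP/matrixP => i j.
have pq' : p%:C * p%:C = 1 - q%:C * q%:C :> R[i].
  by apply/eqP; rewrite eq_sym subr_eq -!expr2 -!rmorphXn -rmorphD pq.
have e (t : R) : expi t * expi (- t) = 1 by rewrite -expiD subrr expi0.
have ag : expi (alpha - gamma) = expi alpha * expi (- gamma) by rewrite expiD.
have bg : expi (beta - gamma) = expi beta * expi (- gamma) by rewrite expiD.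
have ag' : expi (- (alpha - gamma)) = expi (- alpha) * expi gamma.
  by rewrite opprB addrC expiD.
have bg' : expi (- (beta - gamma)) = expi (- beta) * expi gamma.
  by rewrite opprB addrC expiD.
have E i' j' : (C0 *m ((C0) ^t*)%sesqui) i' j' =
   C0 i' 0 * conjc (C0 j' 0) + C0 i' 1 * conjc (C0 j' 1).
  rewrite mxE !big_ord_recl big_ord0 addr0 !mxE.
  by have -> : lift ord0 ord0 = 1 :> 'I_2 by exact/val_inj.
have cM (r t : R) : conjc (r%:C * expi t) = r%:C * expi (- t).
  by rewrite rmorphM [X in X * _]conjc_real expiN.
have cN (z : R[i]) : conjc (- z) = - conjc z by rewrite rmorphN.
rewrite E [RHS]mxE.
have ea := e alpha; have eb := e beta; have eg := e gamma.
case: (ord2E i) => ->; case: (ord2E j) => ->;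
  rewrite ?coin0_00 ?coin0_01 ?coin0_10 ?coin0_11 ?cN ?cM ?opprK ?ag' ?bg' ?ag
    ?bg /=;
  ring: ea eb eg pq'.
Qed.

Definition coin0 : coin R := Coin (fun _ : int => coin0_unitary).

Definition free_step psi : ell2 R := shift (coin_op coin0 psi).

(* key below is Cayley-Hamilton for the symbol of the free walk, whose
   determinant is e^(i gamma) and whose trace is the symbol of H. *)
Lemma free_below (l : R[i]) : 0 < p -> cmod l = 1 ->
  p < `|complex.Re (l * expi (- (gamma / 2)))| ->
  exists2 K : R, 0 <= K & forall psi, N2 psi <= K * N2 (free_step psi - l *:
    psi).
Proof.
move=> p0 l1 pc; set c := complex.Re _ in pc.
pose a := coin0 0 0 0; pose d := coin0 0 1 1.
have ma : cmod a ^+ 2 = p ^+ 2.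
  by rewrite /a /= coin0_00 cmodM cmodR cmod_expi mulr1 real_normK ?num_real.
have md : cmod d ^+ 2 = p ^+ 2.
  by rewrite /d /= coin0_11 cmodM cmodR cmod_expi mulr1 real_normK ?num_real.
pose H psi := a *: translate 1 psi + d *: translate (-1) psi.
have NH psi : N2 (H psi) <= 4 * p ^+ 2 * N2 psi.
  apply: le_trans (N2_add2 _ _) _.
  by rewrite !N2Z !N2_translate ma md; lra.
have key psi (phi := free_step psi - l *: psi) :
    (l ^+ 2 + expi gamma) *: psi = l *: H psi + (H phi - (l *: phi + free_step
      phi)).
  have s0 u x : free_step u x 0 0 =
      a * u (x + 1) 0 0 + coin0 0 0 1 * u (x + 1) 1 0 by rewrite step0E.
  have s1 u x : free_step u x 1 0 =
      coin0 0 1 0 * u (x - 1) 0 0 + d * u (x - 1) 1 0 by rewrite step1E.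
  have tE y u x i : translate y u x i 0 = u (x + y) i 0 by [].
  have det : expi gamma = a * d - coin0 0 0 1 * coin0 0 1 0.
    by rewrite coin0_det.
  rewrite /phi /H det {phi det}; clear NH H ma md; move: s0 s1 tE.
  move: free_step (@translate) (a) (d) => f t {}a {}d s0 s1 tE.
  apply: entry_eq => x;
    rewrite !(ell2_entryD, ell2_entryN, ell2_entryZ, tE, s0, s1) ?addrK ?subrK;
    ring.
have lam : cmod (l ^+ 2 + expi gamma) ^+ 2 = 4 * c ^+ 2.
  pose h := expi (gamma / 2); pose m := l * expi (- (gamma / 2)).
  have hh : h * expi (- (gamma / 2)) = 1 by rewrite -expiD subrr expi0.
  have h2 : expi gamma = h * h by rewrite -expiD -splitr.
  have m1 : cmod m = 1 by rewrite cmodM cmod_expi l1 mulr1.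
  have lE : l = m * h by rewrite /m -mulrA [_ * h]mulrC hh mulr1.
  have mm : m * conjc m = 1 by rewrite mul_conj m1 expr1n.
  have -> : l ^+ 2 + expi gamma = h * h * m * (m + conjc m).
    by rewrite lE h2; ring: mm.
  rewrite addcJ !cmodM !cmod_expi l1 !mul1r cmodR.
  have -> : cmod (2%:R : R[i]) = 2
    by rewrite -(rmorph_nat (real_complex R)) cmodR normr_nat.
  by rewrite exprMn real_normK ?num_real // -natrX.
have pc2 : p ^+ 2 < c ^+ 2.
  by rewrite -[ltRHS]real_normK ?num_real // ltr_sqr ?nnegrE // ltW.
have pp : 0 < p ^+ 2 by rewrite exprn_gt0.
(* The gap between [4 * c ^+ 2], the squared modulus on the left of [key], and the bound
   [4 * p ^+ 2] for [H] is [4 * g]. The weight [s] spends half of it and leaves [2 * g] in front of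
   [N2 psi]. *)
pose g := c ^+ 2 - p ^+ 2; pose s := g / (2 * p ^+ 2).
have g0 : 0 < g by rewrite subr_gt0.
have s0 : 0 < s by rewrite divr_gt0 // mulr_gt0.
have sp : (1 + s) * (4 * p ^+ 2) = 4 * c ^+ 2 - 2 * g.
  by rewrite /s /g; field; rewrite lt0r_neq0.
have sV : 0 < s^-1 by rewrite invr_gt0.
exists ((1 + s^-1) * (8 * p ^+ 2 + 8) / (2 * g)) => [|psi].
  by rewrite divr_ge0 ?mulr_ge0 //; lra.
have := congr1 (@N2 R) (key psi).
rewrite N2Z lam; set phi := free_step psi - l *: psi => E.
have h1 := N2_young (l *: H psi) (H phi - (l *: phi + free_step phi)) s0.
rewrite -E N2Z l1 expr1n mul1r in h1.
have h2 := N2_sub2 (H phi) (l *: phi + free_step phi).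
have h3 := N2_add2 (l *: phi) (free_step phi).
rewrite N2Z l1 expr1n mul1r N2_step in h3.
have h4 := NH phi; have h5 := NH psi.
set t := N2 (l *: phi + _) in h2 h3; set r := N2 (H phi - _) in h1 h2.
move: h1 h2 h3 h4 h5; move: r t (N2 (H phi)) (N2 (H psi)) (N2 phi) (N2 psi).
move=> r t n1 n2 x y h1 h2 h3 h4 h5.
have h6 : (1 + s^-1) * r <= (1 + s^-1) * ((8 * p ^+ 2 + 8) * x).
  rewrite ler_wpM2l //; [lra|clear -h2 h3 h4; lra].
have h7 : (1 + s) * n2 <= (1 + s) * (4 * p ^+ 2 * y) by rewrite ler_wpM2l //;
  lra.
rewrite [X in _ <= X]mulrA sp in h7.
rewrite [leRHS]mulrAC ler_pdivlMr; last by lra.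
by move: h1 h6 h7; clear; lra.
Qed.

End ConstantCoin.
End FreeWalk.

(** * The bands *)

Section Arcs.
Variable R : realType.
Implicit Types p gamma t u : R.

Lemma Re_expiB t u : complex.Re (expi t * expi (- u)) = cos (t - u).
Proof. by rewrite -expiD. Qed.

Lemma cos_ltW (x y : R) : 0 <= x -> x <= y -> y <= pi -> cos y <= cos x.
Proof.
move=> x0 xy ypi.
rewrite leNgt ltr_cos ?in_itv /= ?x0 ?ypi ?andbT /= -?leNgt //.
  exact: le_trans x0 xy.
exact: le_trans xy ypi.
Qed.

Lemma acos_itv p : -1 <= p <= 1
  -> [/\ 0 <= acos p, acos p <= pi & cos (acos p) = p].
Proof. by move=> /acos_def[/andP[]]. Qed.

Lemma cos_le_iff (x y : R) : 0 <= x <= pi -> 0 <= y <= pi ->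
  (cos x <= cos y) = (y <= x).
Proof. by move=> hx hy; rewrite !leNgt ltr_cos ?in_itv. Qed.

Lemma arcs_cos p gamma t : 0 <= p <= 1 ->
  arcs p gamma t -> `|cos (t - gamma / 2)| <= p.
Proof.
move=> /andP[p0 p1]; have [|a0 api ca] := @acos_itv p; first by apply/andP;
  split; lra.
rewrite /arcs /= !in_itv /=.
have main u : acos p <= u <= pi - acos p -> `|cos u| <= p.
  move=> /andP[u1 u2]; rewrite ler_norml; apply/andP; split; last first.
    by rewrite -ca; apply: cos_ltW => //; lra.
  have -> : - p = cos (pi - acos p) by rewrite addrC cosDpi cosN ca.
  by apply: cos_ltW; lra.
move=> [] /andP[t1 t2]; first by apply: main; apply/andP; split; lra.
have -> : t - gamma / 2 = (t - gamma / 2 - pi) + pi by lra.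
by rewrite cosDpi normrN; apply: main; apply/andP; split; lra.
Qed.

Lemma arc_ends_cos p gamma t : 0 <= p <= 1 ->
  arc_ends p gamma t -> `|cos (t - gamma / 2)| = p.
Proof.
move=> /andP[p0 p1]; have [|a0 api ca] := @acos_itv p; first by apply/andP;
  split; lra.
have np : `|p| = p by exact: ger0_norm.
case=> ->; rewrite addrK.
- by rewrite ca.
- by rewrite addrC cosDpi cosN ca normrN.
- by rewrite addrC cosDpi ca normrN.
- by rewrite mulr_natl addrC cosD2pi cosN ca.
Qed.

Lemma arcs_interior_cos p gamma t : 0 <= p <= 1 ->
  arcs p gamma t -> ~ arc_ends p gamma t -> `|cos (t - gamma / 2)| < p.
Proof.
move=> /andP[p0 p1]; have [|a0 api ca] := @acos_itv p; first by apply/andP;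
  split; lra.
rewrite /arcs /= !in_itv /=.
have main u : acos p < u < pi - acos p -> `|cos u| < p.
  move=> /andP[u1 u2]; rewrite ltr_norml; apply/andP; split; last first.
    by rewrite -ca ltr_cos // in_itv /=; apply/andP; split; lra.
  have -> : - p = cos (pi - acos p) by rewrite addrC cosDpi cosN ca.
  by rewrite ltr_cos // in_itv /=; apply/andP; split; lra.
move=> [] /andP[t1 t2] ne.
  have n1 : t != acos p + gamma / 2 by apply/eqP => e; apply: ne; constructor 1.
  have n2 : t != pi - acos p + gamma / 2 by apply/eqP => e; apply: ne;
    constructor 2.
  have s1 : acos p + gamma / 2 < t by rewrite lt_def n1.
  have s2 : t < pi - acos p + gamma / 2 by rewrite lt_def eq_sym n2.
  by apply: main; apply/andP; split; lra.
have n1 : t != pi + acos p + gamma / 2 by apply/eqP => e; apply: ne;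
  constructor 3.
have n2 : t != 2 * pi - acos p + gamma / 2 by apply/eqP => e; apply: ne;
  constructor 4.
have s1 : pi + acos p + gamma / 2 < t by rewrite lt_def n1.
have s2 : t < 2 * pi - acos p + gamma / 2 by rewrite lt_def eq_sym n2.
have -> : t - gamma / 2 = (t - gamma / 2 - pi) + pi by lra.
by rewrite cosDpi normrN; apply: main; apply/andP; split; lra.
Qed.

(** After a rotation by [- gamma / 2] the two arcs lie in the upper and the lower half circle, so
    the sign of the imaginary part decides which of them contains the angle. *)
Lemma arcs_of_Re p gamma (l : R[i]) : 0 <= p <= 1 -> cmod l = 1 ->
  `|complex.Re (l * expi (- (gamma / 2)))| <= p ->
  exists2 t, arcs p gamma t & expi t = l.
Proof.
move=> /andP[p0 p1] l1; set m := l * _ => hm.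
have m1 : cmod m = 1 by rewrite cmodM l1 cmod_expi mul1r.
have lE : l = m * expi (gamma / 2).
  by rewrite /m -mulrA -expiD addNr expi0 mulr1.
have [|a0 api ca] := @acos_itv p; first by apply/andP; split; lra.
move: hm; rewrite ler_norml => /andP[h1 h2].
have sq : complex.Re m ^+ 2 + complex.Im m ^+ 2 = 1
  by rewrite -cmod_sqr m1 expr1n.
have [|b0 bpi cb] := @acos_itv (complex.Re m); first by apply/andP; split; lra.
have ab : acos p <= acos (complex.Re m).
  by rewrite -cos_le_iff ?ca ?cb // ?a0 ?b0.
have ba : acos (complex.Re m) <= pi - acos p.
  rewrite -cos_le_iff ?cb ?b0 //; last by apply/andP; split; lra.
  by rewrite addrC cosDpi cosN ca.
have sb : sin (acos (complex.Re m)) = `|complex.Im m|.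
  rewrite sin_acos; last by apply/andP; split; lra.
  by rewrite -sq addrAC subrr add0r sqrtr_sqr.
have mE : m = complex.Re m +i* complex.Im m by case: (m).
rewrite /arcs lE; have [i0|i0] := leP 0 (complex.Im m).
  exists (acos (complex.Re m) + gamma / 2).
    by left; rewrite /= in_itv /= !lerD2r ab.
  by rewrite expiD {2}mE /expi cb sb ger0_norm.
exists (2 * pi - acos (complex.Re m) + gamma / 2).
  by right; rewrite /= in_itv /=; apply/andP; split; lra.
rewrite expiD {2}mE; congr (_ * _).
rewrite /expi mulr_natl [_ *+ 2 - _]addrC cosD2pi sinD2pi cosN sinN cb sb.
by rewrite ltr0_norm // opprK.
Qed.

End Arcs.

(** * Essential spectrum of the perturbed walk *)

Section Perturbation.
Variable R : realType.
Implicit Types (psi phi : ell2 R) (D : coin R).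

(** Fixes how close to [C0] the coins must be: at distance [eta = (16 * K + 16)^-1] the two steps
    differ by at most [4 * eta ^+ 2 * N2 psi]. This enters a lower bound with constant [K] through
    the factor [2 * K], and so costs at most half of [N2 psi]. *)
Lemma small_coupling (K : R) : 0 <= K -> 16 * (K * (16 * K + 16)^-1 ^+ 2) <= 1.
Proof.
move=> K0; set eta := _^-1; have E0 : 0 < 16 * K + 16 by lra.
have eta0 : 0 <= eta by rewrite invr_ge0 ltW.
have ee : eta * (16 * K + 16) = 1 by rewrite mulVf ?lt0r_neq0.
have k0 : 0 <= K * eta by rewrite mulr_ge0.
have k1 : (1 - 16 * (K * eta)) * eta >= 0 by rewrite mulr_ge0 //; lra.
lra.
Qed.

Lemma entry_le_mx_norm (A : 'M[R[i]]_2) (c : R) i j :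
  mx_norm A <= c%:C -> cmod (A i j) <= c.
Proof.
move=> h; rewrite -lecR cmod_normr; apply: le_trans h.
rewrite mx_normE -[leLHS]nngE num_le.
exact: (le_bigmax _ (fun ij => `|A ij.1 ij.2|%:nng) (i, j)).
Qed.

(** The threshold [L] makes the property insensitive to finitely many sites, so that it passes from
    [C2] to the coin of the walk, whatever happens on [e]. *)
Definition asymptotic D (A : 'M[R[i]]_2) : Prop :=
  exists (r M : R) (L : nat), [/\ 0 <= r < 1, 0 <= M &
    forall (x : int) i j, (L <= absz x)%N ->
      cmod ((D x - A) i j) <= r ^+ absz x * M].

Lemma le_japanese_bracket (x : int) : (absz x)%:R <= japanese_bracket R x.
Proof.
rewrite /japanese_bracket -[leLHS]ger0_norm // -sqrtr_sqr ler_wsqrtr //.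
by rewrite -natrX -abszX natr_absz ger0_norm ?sqr_ge0 // rmorphXn lerDr.
Qed.

Lemma asymptotic_of_decay D (A : 'M[R[i]]_2) :
  (exists rho M : R, [/\ 0 < rho, 0 < M & forall x : int,
     mx_norm (D x - A) <= (M * expR (- rho * japanese_bracket R x))%:C]) ->
  asymptotic D A.
Proof.
move=> [rho [M [rho0 M0 h]]].
exists (expR (- rho)), M, 0%N; split.
- by rewrite expR_ge0 expR_lt1 oppr_lt0.
- exact: ltW.
move=> x i j _; apply: le_trans (entry_le_mx_norm i j (h x)) _.
rewrite mulrC ler_wpM2r ?(ltW M0) // -expRM_natl ler_expR mulrC.
by rewrite ler_wnM2r ?oppr_le0 ?(ltW rho0) // le_japanese_bracket.
Qed.

Lemma pair_union_bounded (N : nat) (y : 'I_N -> int) :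
  exists B : nat, forall x, pair_union y x -> (absz x < B)%N.
Proof.
exists (\sum_(j < N) (absz (y j)).+2)%N => x [j _ hx].
rewrite (bigD1 j) //=; apply: leq_trans (leq_addr _ _).
by case: hx => -> /=; lia.
Qed.

Lemma asymptotic_walk (N : nat) (y : 'I_N -> int) C1 C2 A :
  asymptotic C2 A -> asymptotic (walk_coin (pair_union y) C1 C2) A.
Proof.
move=> [r [M [L [r01 M0 h]]]]; have [B hB] := pair_union_bounded y.
exists r, M, (maxn L B); split => // x i j.
rewrite geq_max => /andP[hL hBx]; rewrite /= memNset; last first.
  by move=> /hB; rewrite ltnNge hBx.
exact: h.
Qed.

Lemma asymptotic_small D A (eta : R) : asymptotic D A -> 0 < eta ->
  exists L : nat, forall (x : int) i j, (L <= absz x)%N ->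
    cmod ((D x - A) i j) <= eta.
Proof.
move=> [r [M [L [r01 M0 h]]]] e0; have [n0 hn] := geometric_small M r01 e0.
exists (maxn L n0) => x i j; rewrite geq_max => /andP[hL hn0].
exact: le_trans (h x i j hL) (hn _ hn0).
Qed.

Lemma sqnorm2_mulmx_le (A : 'M[R[i]]_2) (v : 'cV[R[i]]_2) (eta : R) : 0 <= eta
  ->
  (forall i j, cmod (A i j) <= eta)
    -> sqnorm2 (A *m v) <= 4 * eta ^+ 2 * sqnorm2 v.
Proof.
move=> e0 hA; rewrite !sqnorm2_sum !mulmx22.
set a := cmod (v 0 0); set b := cmod (v 1 0).
have row i : cmod (A i 0 * v 0 0 + A i 1 * v 1 0) ^+ 2 <=
    eta ^+ 2 * (2 * (a ^+ 2 + b ^+ 2)).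
  apply: (@le_trans _ _ ((eta * (a + b)) ^+ 2)).
    rewrite ler_sqr ?nnegrE ?cmod_ge0 ?mulr_ge0 ?addr_ge0 ?cmod_ge0 //.
    apply: le_trans (cmod_triangle _ _) _; rewrite !cmodM mulrDr.
    by rewrite lerD // ler_wpM2r ?cmod_ge0.
  rewrite exprMn ler_wpM2l ?sqr_ge0 //.
  by have := sqr_ge0 (a - b); lra.
by have := row 0; have := row 1; lra.
Qed.

Definition box (L : nat) : seq (int * 'I_2) :=
  [seq (x, i) | x <- [seq n%:Z - L%:Z | n <- iota 0 (2 * L)], i <- enum 'I_2].

Lemma vanish_box L psi x : vanish (@coord_form R) (box L) psi ->
  (absz x < L)%N -> psi x = 0.
Proof.
move=> hv hx; apply/colP => i; rewrite mxE.
apply: (hv (x, i)); apply/allpairsP; exists (x, i).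
split; [|by rewrite mem_enum|by []].
apply/mapP; exists (absz (x + L%:Z)); last by rewrite /=; lia.
by rewrite mem_iota; lia.
Qed.

Lemma step_diff D p q alpha beta gamma (pq : p ^+ 2 + q ^+ 2 = 1) psi :
  N2 (free_step alpha beta gamma pq psi - shift (coin_op D psi)) =
  zsum (fun x => sqnorm2 ((coin0_mx p q alpha beta gamma - D x) *m psi x)).
Proof.
rewrite /free_step -linearB N2_shift /N2; congr zsum; apply/funext => x.
by rewrite ell2D ell2N !coin_opE -mulmxBl.
Qed.

(** The pointwise alternative covers both uses: functions that vanish on a box outside which the
    coins are close, and waves supported far out. *)
Lemma step_close D p q alpha beta gamma (pq : p ^+ 2 + q ^+ 2 = 1) (eta : R) psi
  :
  0 <= eta ->
  (forall x, psi x = 0 \/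
     forall i j, cmod ((D x - coin0_mx p q alpha beta gamma) i j) <= eta) ->
  N2 (free_step alpha beta gamma pq psi - shift (coin_op D psi)) <=
    4 * eta ^+ 2 * N2 psi.
Proof.
move=> eta0 h; have c0 : 0 <= 4 * eta ^+ 2 := mulr_ge0 (ler0n _ 4) (sqr_ge0 _).
rewrite step_diff -(zsumZ c0 (ell2_zsummable psi)).
apply: zsum_le => [x||x]; first exact: sqnorm2_ge0.
  exact: zsummableZ c0 (ell2_zsummable psi).
have [->|hx] := h x.
  by rewrite mulmx0 sqnorm2_0 mulr0.
apply: sqnorm2_mulmx_le => // i j.
have := hx i j; rewrite -cmodN; congr (cmod _ <= _).
by rewrite !mxE opprB.
Qed.

Lemma step_below_on D p q alpha beta gamma (pq : p ^+ 2 + q ^+ 2 = 1) (l : R[i])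
  :
  asymptotic D (coin0_mx p q alpha beta gamma) ->
  0 < p -> cmod l = 1 -> p < `|complex.Re (l * expi (- (gamma / 2)))| ->
  exists L (K : R), 0 <= K /\
  below_on (@N2 R) (@coord_form R) (fun psi => shift (coin_op D psi) - l *: psi)
    (box L) K.
Proof.
move=> hD p0 l1 lp; have [K K0 hK] := free_below alpha beta pq p0 l1 lp.
pose eta := (16 * K + 16)^-1; have E0 : 0 < 16 * K + 16 by lra.
have eta0 : 0 < eta by rewrite invr_gt0.
have [L hL] := asymptotic_small hD eta0.
exists L, (4 * K); split=> [|psi hv]; first lra.
have d : N2 (free_step alpha beta gamma pq psi - shift (coin_op D psi)) <=
    4 * eta ^+ 2 * N2 psi.
  apply: step_close => [|x]; first exact: ltW.
  have [hx|hx] := leqP L (absz x); last by left; exact: vanish_box hv hx.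
  by right => i j; exact: hL.
have h1 := hK psi.
have h2 := sqn_via (@ell2_hilbert R) (shift (coin_op D psi))
  (free_step alpha beta gamma pq psi) (l *: psi).
rewrite (sqn_subC (@ell2_hilbert R) (l *: psi)) in h2.
move: d h1 h2 (N2_ge0 psi).
move: (N2 (_ - _)) (N2 (_ - _)) (N2 (_ - _)) (N2 psi) => a b c n d h1 h2 n0.
have k2 := small_coupling K0; rewrite -/eta in k2.
have h3 := ler_wpM2l K0 h2.
have h4 := ler_wpM2l K0 d.
have h5 := ler_wpM2r n0 k2.
lra.
Qed.

End Perturbation.

(** * Weyl sequences on the arcs *)

Section WeylSequence.
Variable R : realType.

Lemma zsum_indicator (t : seq int) (c : R) : uniq t -> 0 <= c ->
  zsummable (fun x => if x \in t then c else 0) /\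
  zsum (fun x => if x \in t then c else 0) = c * (size t)%:R.
Proof.
move=> ut c0; have pos (x : int) : 0 <= (if x \in t then c else 0) by case: ifP.
have upper (s : seq int) : uniq s ->
    \sum_(x <- s) (if x \in t then c else 0) <= c * (size t)%:R.
  move=> us; rewrite -big_mkcond /= -big_filter big_const_seq count_predT.
  rewrite iter_addr_0 -[leLHS]mulr_natr ler_wpM2l // ler_nat uniq_leq_size
    ?filter_uniq //.
  by move=> x; rewrite mem_filter => /andP[].
have [hs hle] := zsum_bound pos upper; split=> //.
apply/eqP; rewrite eq_le hle /=; apply: le_trans (zsum_seq ut hs).
rewrite big_seq (eq_bigr (fun=> c)) => [|x ->//].
by rewrite -big_seq big_const_seq count_predT iter_addr_0 mulr_natr.
Qed.

Definition dyadic_sites (n : nat) : seq int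
  := [seq (n + j)%N%:Z | j <- iota 0 n].

Lemma dyadic_sites_uniq n : uniq (dyadic_sites n).
Proof. by rewrite map_inj_uniq ?iota_uniq // => i j []; lia. Qed.

Lemma mem_dyadic_sites n (x : int) :
  (x \in dyadic_sites n) = (n%:Z <= x) && (x < 2 * n%:Z).
Proof.
apply/mapP/idP => [[j]|h]; first by rewrite mem_iota => ? ->; lia.
by exists (absz x - n)%N; [rewrite mem_iota|]; lia.
Qed.

Lemma dyadic_sites_ge n (x : int) : x \in dyadic_sites n -> (n <= absz x)%N.
Proof. by rewrite mem_dyadic_sites; lia. Qed.

Lemma dyadic_sites_edge n (x : int) :
  x \notin undup [:: n%:Z - 1; n%:Z; 2 * n%:Z - 1; 2 * n%:Z] ->
  (x + 1 \in dyadic_sites n) = (x \in dyadic_sites n) /\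
  (x - 1 \in dyadic_sites n) = (x \in dyadic_sites n).
Proof. by rewrite mem_undup !inE !mem_dyadic_sites => h; split; apply/idP/idP;
  lia. Qed.

Lemma singular_solution (F : fieldType) (a b c d : F) : a * d - b * c = 0 ->
  exists x y, [/\ (x, y) != (0, 0), a * x + b * y = 0 & c * x + d * y = 0].
Proof.
move=> h; have [ab|ab] := eqVneq (b, a) (0, 0).
  have [cd|cd] := eqVneq (d, c) (0, 0).
    exists 1, 0; move: ab cd => [-> ->] [-> ->].
    by rewrite !mul0r !addr0; split => //; rewrite xpair_eqE oner_eq0.
  exists d, (- c); split; last by ring.
    by apply: contra cd; rewrite !xpair_eqE oppr_eq0.
  by move: ab => [-> ->]; rewrite !mul0r addr0.
exists (- b), a; split; [|by ring|by rewrite -h; ring].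
by apply: contra ab; rewrite !xpair_eqE oppr_eq0.
Qed.

(** Balance of the truncated wave: [m] is its mass, [w] the mass per site, [A] the defect of the
    free eigenvalue equation at the four edge sites and [B] the error from the coins. Half of [m]
    absorbs [B], which leaves [w * n <= 16 * K * w], too small for the chosen [n]. *)
Lemma weyl_contradiction (K w n A B c m : R) : 0 <= K -> 0 < w ->
  16 * K + 16 < n -> A <= 4 * w -> B <= 4 * (16 * K + 16)^-1 ^+ 2 * m ->
  m <= K * c -> c <= 2 * B + 2 * A -> m = w * n -> 0 <= m -> False.
Proof.
move=> K0 w0 nK hA hB h1 h2 mE m0; have k2 := small_coupling K0.
have h3 := ler_wpM2l K0 h2.
have h4 := ler_wpM2l K0 hA.
have h5 := ler_wpM2l K0 hB.
have h6 := ler_wpM2r m0 k2.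
have h7 : w * (16 * K + 16) < w * n by rewrite ltr_pM2l.
lra.
Qed.

Variables (p q alpha beta gamma : R).
Hypothesis pq : p ^+ 2 + q ^+ 2 = 1.
Let C0 := coin0_mx p q alpha beta gamma.

(** The pair [(v0, v1)] is an eigenvector of the symbol of the free walk at momentum [k]. The symbol
    has determinant [e^(i gamma)] and trace [2 c e^(i gamma / 2)], so [e^(i t)] is a root of its
    characteristic polynomial. *)
Lemma plane_wave (t : R) : 0 < p -> `|cos (t - gamma / 2)| <= p ->
  exists k v0 v1, [/\ (v0, v1) != (0, 0),
    (C0 0 0 * v0 + C0 0 1 * v1) * expi k = expi t * v0 &
    (C0 1 0 * v0 + C0 1 1 * v1) * expi (- k) = expi t * v1].
Proof.
move=> p0; set c := cos _ => cp.
(* The momentum k solves p cos (k + alpha - gamma / 2) = cos (t - gamma / 2). *)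
pose kappa := acos (c / p).
have ck : p * cos kappa = c.
  have [|_ _ ->] := @acos_itv _ (c / p);
    last by rewrite mulrC divfK // lt0r_neq0.
  by rewrite -ler_norml normrM normfV (gtr0_norm p0) ler_pdivrMr // mul1r.
pose k := kappa - alpha + gamma / 2.
pose z := expi k; pose z' := expi (- k); pose l := expi t.
have zz : z * z' = 1 by rewrite -expiD subrr expi0.
have [|v0 [v1 [vn e0 e1]]] :=
    @singular_solution _ (C0 0 0 * z - l) (C0 0 1 * z) (C0 1 0 * z') (C0 1 1 *
      z' - l).
  pose h := expi (gamma / 2).
  have tr : C0 0 0 * z + C0 1 1 * z' = h * (2 * c)%:C.
    rewrite /C0 coin0_00 coin0_11 -!mulrA -!expiD -mulrDr.
    have -> : alpha + k = gamma / 2 + kappa by rewrite /k; lra.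
    have -> : - (alpha - gamma) + - k = gamma / 2 - kappa by rewrite /k; lra.
    rewrite !expiD expiN -mulrDr addcJ /= -ck rmorphM /= mulrCA; congr (_ * _).
    by rewrite !rmorphM /= rmorph_nat mulrCA.
  have chr : l ^+ 2 + expi gamma = l * (h * (2 * c)%:C).
    have -> : expi gamma = h * h by rewrite -expiD -splitr.
    have lE : l = expi (t - gamma / 2) * h by rewrite -expiD subrK.
    have mm : expi (t - gamma / 2) * conjc (expi (t - gamma / 2)) = 1
      by exact: expi_conj.
    have -> : (2 * c)%:C = expi (t - gamma / 2) + conjc (expi (t - gamma / 2)).
      by rewrite addcJ rmorphM /= rmorph_nat.
    by rewrite lE; ring: mm.
  have det := coin0_det alpha beta gamma pq; rewrite -/C0 in det.
  have det' : C0 0 1 * C0 1 0 = C0 0 0 * C0 1 1 - expi gamma by rewrite -det;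
    ring.
  have -> : (C0 0 0 * z - l) * (C0 1 1 * z' - l) - C0 0 1 * z * (C0 1 0 * z') =
     C0 0 0 * C0 1 1 * (z * z') - C0 0 1 * C0 1 0 * (z * z')
     - l * (C0 0 0 * z + C0 1 1 * z') + l ^+ 2 by ring.
  by rewrite zz !mulr1 det tr addrAC [expi gamma + _]addrC chr subrr.
exists k, v0, v1; split=> //.
  apply: subr0_eq; rewrite -[RHS]e0 /z /l; ring.
by apply: subr0_eq; rewrite -[RHS]e1 /z' /l; ring.
Qed.

Lemma arcs_in_spectrum (D : coin R) (U : {linear ell2 R -> ell2 R}) (t : R) :
  (forall psi, U psi = shift (coin_op D psi)) -> asymptotic D C0 ->
  0 < p <= 1 -> arcs p gamma t -> spectrum U (expi t).
Proof.
move=> UE hD /andP[p0 p1] ht; have p01 : 0 <= p <= 1 by rewrite ltW.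
have [k [v0 [v1 [vn e0 e1]]]] := plane_wave p0 (arcs_cos p01 ht).
move=> /resolvent_below[K K0 hK].
pose eta := (16 * K + 16)^-1; have E0 : 0 < 16 * K + 16 by lra.
have eta0 : 0 < eta by rewrite invr_gt0.
have [L hL] := asymptotic_small hD eta0.
(* Starting beyond [L] keeps the coins [eta]-close on the support; the second bound makes the mass
   outweigh the edges. *)
pose n := maxn L (Num.truncn (16 * K + 16)).+1.
have nK : 16 * K + 16 < n%:R.
  by apply: lt_le_trans (truncnS_gt _) _; rewrite ler_nat leq_maxr.
pose sites := dyadic_sites n; have us : uniq sites := dyadic_sites_uniq n.
have inE' := mem_dyadic_sites n.
pose v : 'cV[R[i]]_2 := \col_(i < 2) if i == 0 then v0 else v1.
pose e (x : int) := expi (k * x%:~R).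
have eS x : e (x + 1) = e x * expi k by rewrite /e intrD mulrDr mulr1 expiD.
have eP x : e (x - 1) = e x * expi (- k) by rewrite /e intrB mulrBr mulr1 expiD.
pose f (x : int) : 'cV[R[i]]_2 := if x \in sites then e x *: v else 0.
have fE x : sqnorm2 (f x) = if x \in sites then sqnorm2 v else 0.
  rewrite /f; case: ifP => _; last exact: sqnorm2_0.
  by rewrite sqnorm2Z cmod_expi expr1n mul1r.
have v_gt0 : 0 < sqnorm2 v.
  rewrite lt_def sqnorm2_ge0 andbT sqnorm2_eq0; apply: contra vn => /eqP v00.
  have := congr1 (fun w : 'cV[R[i]]_2 => w 0 0) v00; rewrite !mxE /= => ->.
  by have := congr1 (fun w : 'cV[R[i]]_2 => w 1 0) v00; rewrite !mxE /= => ->.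
have [fs fsum] := zsum_indicator us (ltW v_gt0).
have fsq : f \in @square_summable R.
  apply: square_summableP.
  have -> : (fun x => sqnorm2 (f x)) =
      (fun x => if x \in sites then sqnorm2 v else 0) by exact/funext.
  exact: fs.
pose psi := Ell2 fsq.
have Npsi : N2 psi = sqnorm2 v * n%:R.
  have -> : N2 psi = zsum (fun x => if x \in sites then sqnorm2 v else 0).
    by congr zsum; apply/funext => x; exact: fE.
  by rewrite fsum size_map size_iota.
pose edges : seq int := undup [:: n%:Z - 1; n%:Z; 2 * n%:Z - 1; 2 * n%:Z].
have [gs gsum] := zsum_indicator (undup_uniq _) (ltW v_gt0) : _ /\ zsum (fun x
  => if x \in edges then _ else _) = _.
have Nfree : N2 (free_step alpha beta gamma pq psi - expi t *: psi) <= 4 *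
  sqnorm2 v.
  apply: (@le_trans _ _ (zsum (fun x => if x \in edges then sqnorm2 v else 0)));
    last first.
    by rewrite gsum mulrC ler_wpM2r ?(ltW v_gt0) // ler_nat size_undup.
  apply: zsum_le => // x; first exact: sqnorm2_ge0.
  pose chi y : R[i] := (y \in sites)%:R.
  have p0E y : psi y 0 0 = chi y * (e y * v0).
    by rewrite /= /f /chi; case: ifP => _; rewrite !mxE ?mul1r ?mul0r.
  have p1E y : psi y 1 0 = chi y * (e y * v1).
    by rewrite /= /f /chi; case: ifP => _; rewrite !mxE ?mul1r ?mul0r.
  set w := _ x.
  (* Where the indicator [chi] of the sites is constant the plane wave solves the free equation, so
     the defect only sees its jumps. *)
  have w0 : w 0 0 = (chi (x + 1) - chi x) * (e x * expi t * v0).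
    rewrite /w ell2_entryD ell2_entryN ell2_entryZ step0E !p0E p1E eS.
    transitivity (chi (x + 1) * e x * ((C0 0 0 * v0 + C0 0 1 * v1) * expi k)
      - chi x * (e x * expi t * v0)); first by rewrite /C0 /=; ring.
    by rewrite e0; ring.
  have w1 : w 1 0 = (chi (x - 1) - chi x) * (e x * expi t * v1).
    rewrite /w ell2_entryD ell2_entryN ell2_entryZ step1E !p1E p0E eP.
    transitivity (chi (x - 1) * e x * ((C0 1 0 * v0 + C0 1 1 * v1) * expi (- k))
      - chi x * (e x * expi t * v1)); first by rewrite /C0 /=; ring.
    by rewrite e1; ring.
  rewrite !sqnorm2_sum w0 w1 !cmodM !cmod_expi !mul1r /v !mxE /=.
  case: ifP => [_|/negbT/dyadic_sites_edge[h1 h2]].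
    have bnd (b c : bool) : cmod (b%:R - c%:R : R[i]) <= 1.
      by case: b; case: c; rewrite ?subrr ?subr0 ?sub0r ?cmodN ?cmod0 ?cmod1
        ?ler01.
    by rewrite !exprMn lerD // ler_piMl ?sqr_ge0 // expr_le1 ?cmod_ge0 ?bnd.
  by rewrite /chi h1 h2 !subrr cmod0 !mul0r expr0n addr0.
have close : N2 (free_step alpha beta gamma pq psi - U psi) <= 4 * eta ^+ 2 * N2
  psi.
  rewrite UE; apply: step_close => [|x]; first exact: ltW.
  rewrite /= /f; case: ifP => hx; last by left.
  right=> i j; apply: hL; apply: leq_trans (leq_maxl _ _) _.
  exact: dyadic_sites_ge hx.
have h1 := hK psi.
have h2 := sqn_via (@ell2_hilbert R) (free_step alpha beta gamma pq psi)
  (U psi) (expi t *: psi).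
rewrite (sqn_subC (@ell2_hilbert R) (U psi) (free_step _ _ _ _ _)) in h2.
rewrite (sqn_subC (@ell2_hilbert R) (expi t *: psi)) in h2.
move: Nfree close h1 h2 Npsi (N2_ge0 psi).
set A := N2 (_ - expi t *: psi); set B := N2 (_ - U psi).
set c := N2 (U psi - _); move: A B c (N2 psi) (sqnorm2 v) v_gt0.
move=> A B c m w w0 hA hB h1 h2 mE m0.
exact: (weyl_contradiction K0 w0 nK hA hB h1 h2 mE m0).
Qed.

Lemma expi_close (e : R) : 0 < e -> exists2 d : R, 0 < d &
  forall u : R, `|u| < d -> cmod (expi u - 1) < e.
Proof.
(* The squared modulus of [expi u - 1] is [2 * (1 - cos u)], whence [e ^+ 2 / 2]. *)
move=> e0; have e2 : 0 < e ^+ 2 / 2 by rewrite divr_gt0 // exprn_gt0.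
have := @continuous_cos R 0; rewrite /continuous_at cos0.
move=> /cvgrPdist_lt/(_ _ e2)/nbhs_ballP[d /= d0 hd].
exists d => // u ud; have := hd u.
rewrite /ball /= sub0r normrN => /(_ ud) h.
suff : cmod (expi u - 1) ^+ 2 < e ^+ 2.
  by rewrite ltr_sqr ?nnegrE ?cmod_ge0 ?(ltW e0).
rewrite cmod_sqr /= subr0.
have := cos2Dsin2 u; have := ler_norm (1 - cos u).
move: h; set c := cos u; set s := sin u; move=> h1 h2 h3.
have s2 : s ^+ 2 = 1 - c ^+ 2 by lra.
rewrite s2; lra.
Qed.

(** Since [p > 0], each arc has positive width [pi - 2 * acos p], and a shift by at most half of it
    stays inside in one of the two directions. The shift is nonzero and below [pi], so it moves the
    point of the circle too. *)
Lemma arcs_no_isolated_point (t d : R) : 0 < p <= 1 -> arcs p gamma t -> 0 < d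
  ->
  exists t', [/\ arcs p gamma t', `|t' - t| < d & expi t' != expi t].
Proof.
move=> /andP[p0 p1] ht d0.
have [|a0 api ca] := @acos_itv _ p; first by apply/andP; split; lra.
have a2 : acos p < pi / 2.
  have hp : 0 <= acos p <= pi by rewrite a0.
  have hpi : 0 <= (pi : R) / 2 <= pi.
    by have h := pi_gt0 R; apply/andP; split; lra.
  by rewrite ltNge -(cos_le_iff hp hpi) ca cos_pihalf -ltNge.
pose w := pi - 2 * acos p; have wE : w = pi - 2 * acos p by [].
have w0 : 0 < w by rewrite /w; lra.
have pi0 := pi_gt0 R.
pose u := Num.min (d / 2) (w / 2).
have u0 : 0 < u by rewrite lt_min !divr_gt0.
have ud : u < d by rewrite gt_min; apply/orP; left; lra.
have uw : u <= w / 2 by rewrite ge_min lexx orbT.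
have uneq (v : R) : `|v| = u -> expi (t + v) != expi t.
  move=> vu; apply/negP => /eqP h.
  have h1 : expi v = 1.
    have : expi t * expi (- t) = 1 by rewrite -expiD subrr expi0.
    by rewrite -{1}h expiD mulrAC -expiD subrr expi0 mul1r.
  have cu : cos u = cos 0.
    by rewrite cos0 -vu cos_norm; have := congr1 (@complex.Re R) h1.
  suff : u = 0 by lra.
  by apply: cos_inj => //; rewrite in_itv /=; apply/andP; split; lra.
have sub (a b : R) : b - a = w -> a <= t <= b ->
    exists v, `|v| = u /\ a <= t + v <= b.
  move=> ab /andP[h1 h2]; have [h|h] := leP (t + u) b.
    by exists u; split; [rewrite gtr0_norm|apply/andP; split; lra].
  by exists (- u); split; [rewrite normrN gtr0_norm|apply/andP; split; lra].
move: ht; rewrite /arcs /= !in_itv /= => -[ht|ht].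
  have [|v [v1 v2]] := sub _ _ _ ht; first by rewrite /w; lra.
  exists (t + v); split; [by left; rewrite /= in_itv| |exact: uneq].
  by rewrite addrC addKr v1.
have [|v [v1 v2]] := sub _ _ _ ht; first by rewrite /w; lra.
exists (t + v); split; [by right; rewrite /= in_itv| |exact: uneq].
by rewrite addrC addKr v1.
Qed.

Lemma arcs_essential (D : coin R) (U : {linear ell2 R -> ell2 R}) (t : R) :
  (forall psi, U psi = shift (coin_op D psi)) -> asymptotic D C0 ->
  0 < p <= 1 -> arcs p gamma t -> essential_spectrum U (expi t).
Proof.
move=> UE hD hp ht; split; first exact: arcs_in_spectrum UE hD hp ht.
move=> [[_ [W /nbhs_ballP[e /= e0 We] Wl]] _ _].
have [d d0 hd] : exists2 d : R, 0 < d & forall u, `|u| < d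
  -> cmod (expi u - 1) < complex.Re e.
  by apply: expi_close; move: e0; rewrite ltcE => /andP[].
(* The radius of a ball in [R[i]] is itself a complex number; positivity in the order of [R[i]]
   forces it to be real. *)
have eE : e = (complex.Re e)%:C.
  by move: e0; rewrite ltcE /=; case: (e) => a b /= /andP[/eqP-> _].
have [t' [ht' tt' ne]] := arcs_no_isolated_point hp ht d0.
have : (W `&` spectrum U) (expi t').
  split; last exact: arcs_in_spectrum UE hD hp ht'.
  apply: We; rewrite -ball_normE /= eE -cmod_normr ltcR.
  have -> : expi t - expi t' = - (expi t * (expi (t' - t) - 1)).
    by rewrite mulrBr mulr1 -expiD [t + _]addrC subrK opprB.
  by rewrite cmodN cmodM cmod_expi mul1r hd.
rewrite Wl => /= h; by rewrite h eqxx in ne.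
Qed.

End WeylSequence.

Section WalkSpectrum.
Variable R : realType.

Lemma essential_spectrumE (p q alpha beta gamma : R) (A : set int) (C1 C2 : coin
  R) :
  p ^+ 2 + q ^+ 2 = 1 -> 0 < p <= 1 ->
  asymptotic (walk_coin A C1 C2) (coin0_mx p q alpha beta gamma) ->
  essential_spectrum (walk A C1 C2) = @expi R @` arcs p gamma.
Proof.
move=> pq hp hD; apply/seteqP; split=> [l hl|_ [t ht <-]]; last first.
  exact: (arcs_essential pq (walkE A C1 C2) hD hp ht).
have /andP[p0 p1] := hp.
have l1 : cmod l = 1.
  exact: (spectrum_circle (@N2_walk _ A C1 C2) (@walk_surj _ A C1 C2) hl.1).
have [h|h] := leP `|complex.Re (l * expi (- (gamma / 2)))| p.
  have p01 : 0 <= p <= 1 by rewrite ltW.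
  by have [t ht <-] := arcs_of_Re p01 l1 h; exists t.
have [L [K [K0 hK]]] := step_below_on pq hD p0 l1 h.
exfalso; apply: (@not_essential _ (walk A C1 C2) (@N2_walk _ A C1 C2)
  (@walk_surj _ A C1 C2) l (box L) K K0) hl.
by move=> psi hv; rewrite walkE; exact: hK.
Qed.

(** * States trapped on a link *)

Section TrappedState.
Variables (beta' gamma' : R) (A : set int) (C2 : coin R) (y : int) (l : R[i]).
Hypothesis Ay : A y.
Hypothesis Ay1 : A (y - 1).
Hypothesis l2 : l ^+ 2 = - expi gamma'.

Let w := expi (gamma' / 2) * expi (beta' - gamma' / 2).

Let l1 : cmod l = 1.
Proof.
have : cmod l ^+ 2 = 1 by rewrite expr2 -cmodM -expr2 l2 cmodN cmod_expi.
by move=> /eqP; rewrite pexpr_eq1 ?cmod_ge0 // => /eqP.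
Qed.

Let l0 : l != 0. Proof. by rewrite -cmod_eq0 l1 oner_eq0. Qed.

(** The walk carries component 1 at [y] to component 0 at [y - 1] with the factor [w]; amplitude 1
    at [y] therefore forces [l^-1 * w] at [y - 1]. The way back closes because [l ^+ 2] is the
    product of the two factors. As only [l ^+ 2] enters, both eigenvalues are treated at once. *)
Definition trapped_fun (x : int) : 'cV[R[i]]_2 :=
  if x == y - 1 then \col_(i < 2) (if i == 0 then l^-1 * w else 0)
  else if x == y then \col_(i < 2) (if i == 0 then 0 else 1) else 0.

Lemma trapped_fun0 x : trapped_fun x 0 0 = if x == y - 1 then l^-1 * w else 0.
Proof. by rewrite /trapped_fun; do 2?case: ifP; rewrite !mxE. Qed.

Lemma trapped_fun1 x : trapped_fun x 1 0 = if x == y then 1 else 0.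
Proof.
rewrite /trapped_fun; case: eqP => [->|_].
  by rewrite mxE /= (_ : (y - 1 == y) = false) //; apply/eqP; lia.
by case: ifP; rewrite !mxE.
Qed.

Fact trapped_subproof : trapped_fun \in @square_summable R.
Proof.
apply: square_summableP.
have us : uniq [:: y - 1; y] by rewrite /= inE andbT; apply/eqP; lia.
have -> : (fun x => sqnorm2 (trapped_fun x)) =
    (fun x => if x \in [:: y - 1; y] then 1 else 0 : R).
  apply/funext => x; rewrite sqnorm2_sum trapped_fun0 trapped_fun1 !inE.
  have [->|_] := eqVneq x (y - 1).
    rewrite (_ : (y - 1 == y) = false); last by apply/eqP; lia.
    by rewrite cmod0 !cmodM cmodV l1 !cmod_expi invr1 !mulr1 expr1n expr0n
      addr0.
  by case: eqP => _; rewrite cmod0 expr0n add0r ?cmod1 ?expr1n ?cmod0 ?expr0n.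
exact: (zsum_indicator us ler01).1.
Qed.

Definition trapped : ell2 R := Ell2 trapped_subproof.

Lemma coin1_00 : coin1_mx beta' gamma' 0 0 = 0.
Proof. by rewrite !mxE /= mulr0. Qed.
Lemma coin1_01 : coin1_mx beta' gamma' 0 1 = w.
Proof. by rewrite !mxE. Qed.
Lemma coin1_10 : coin1_mx beta' gamma' 1 0 =
  - (expi (gamma' / 2) * expi (- (beta' - gamma' / 2))).
Proof. by rewrite !mxE /= mulrN. Qed.
Lemma coin1_11 : coin1_mx beta' gamma' 1 1 = 0.
Proof. by rewrite !mxE /= mulr0. Qed.

Lemma coin1_10_w : coin1_mx beta' gamma' 1 0 * w = l ^+ 2.
Proof.
rewrite coin1_10 l2 /w mulNr mulrACA -[expi (- _) * _]expiD addNr expi0 mulr1.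
by rewrite -expiD -splitr.
Qed.

Lemma trapped0E x : trapped x 0 0 = if x == y - 1 then l^-1 * w else 0.
Proof. exact: trapped_fun0. Qed.

Lemma trapped1E x : trapped x 1 0 = if x == y then 1 else 0.
Proof. exact: trapped_fun1. Qed.

Lemma trapped_eigenvector : eigenvector (walk A (coin1 beta' gamma') C2) l
  trapped.
Proof.
have cE x : (x == y - 1) || (x == y) ->
    walk_coin A (coin1 beta' gamma') C2 x = coin1_mx beta' gamma'.
  by move=> /orP[/eqP->|/eqP->]; rewrite /= mem_set.
split.
  apply/eqP => h; have := trapped1E y; rewrite h eqxx ell2_0 mxE => /eqP.
  by rewrite eq_sym oner_eq0.
apply: entry_eq => x; rewrite ell2_entryZ ?walk0E ?walk1E !trapped0E !trapped1E.
  have [e1|e1] := eqVneq (x + 1) (y - 1).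
    rewrite cE ?e1 ?eqxx // coin1_00 mul0r.
    rewrite (_ : (y - 1 == y) = false); last by apply/eqP; lia.
    by rewrite (_ : (x == y - 1) = false) ?mulr0 ?addr0 //; apply/eqP; lia.
  rewrite mulr0 add0r; have [e2|e2] := eqVneq (x + 1) y.
    rewrite cE ?e2 ?eqxx ?orbT // coin1_01 mulr1.
    by rewrite (_ : (x == y - 1) = true) ?mulVKf //; apply/eqP; lia.
  by rewrite (_ : (x == y - 1) = false) ?mulr0 //; apply/eqP; lia.
have [e1|e1] := eqVneq (x - 1) (y - 1).
  rewrite cE ?e1 ?eqxx //.
  rewrite (_ : (y - 1 == y) = false) ?mulr0 ?addr0; last by apply/eqP; lia.
  rewrite (_ : (x == y) = true) ?mulr1; last by apply/eqP; lia.
  by rewrite mulrCA coin1_10_w expr2 mulrA mulVf ?mul1r.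
rewrite mulr0 add0r (_ : (x == y) = false) ?mulr0; last by apply/eqP; lia.
have [e2|e2] := eqVneq (x - 1) y; last by rewrite mulr0.
by rewrite cE ?e2 ?eqxx ?orbT // coin1_11 mul0r.
Qed.

Lemma trapped_supp : supp trapped `<=` A.
Proof.
move=> x; rewrite /supp /= /trapped_fun; case: (x =P y - 1) => [->//|_].
by case: (x =P y) => [->//|_]; rewrite eqxx.
Qed.

End TrappedState.
End WalkSpectrum.

(** * Eigenfunctions inside the bands *)

Section AsymptoticVanishing.
Variable R : realType.

(* If u is at most B beyond J then it is at most B / 2 there, because the
   increments beyond J add up to at most B / 2 and u gets arbitrarily small. *)
Lemma slowly_varying_vanish (u : nat -> R) (C r A : R) : 0 <= r < 1 -> 0 <= C ->
  (forall n, 0 <= u n <= A) ->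
  (forall n, u n <= u n.+1 + C * r ^+ n * (u n + u n.+1)) ->
  (forall (e : R) n, 0 < e -> exists2 k, (n <= k)%N & u k <= e) ->
  exists J, forall n, (J <= n)%N -> u n = 0.
Proof.
move=> r01 C0 uA hu small; have /andP[r0 r1] := r01.
have d0 : 0 < 1 - r by rewrite subr_gt0.
(* If [u <= B] from [n] on, the increments from [n] on sum to at most [2 * C * B * r ^+ n / (1 - r)
   = G * B * r ^+ n]; [J] is chosen to make this at most [B / 2]. *)
pose G := 2 * C / (1 - r).
have G0 : 0 <= G by rewrite divr_ge0 ?mulr_ge0 // ltW.
have GE : G * (1 - r) = 2 * C by rewrite divfK // lt0r_neq0.
have [J hJ] := geometric_small G r01 (divr_gt0 ltr01 (ltr0n _ 2)).
exists J => n hn.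
have half (B : R) : 0 <= B -> (forall n, (J <= n)%N -> u n <= B) ->
    forall n, (J <= n)%N -> u n <= B / 2.
  move=> B0 hB {hn}{}n hn.
  have tele d : u n <= u (n + d)%N + G * B * (r ^+ n - r ^+ (n + d)).
    elim: d => [|d ih]; first by rewrite addn0 subrr mulr0 addr0.
    rewrite addnS; have h1 := hu (n + d)%N.
    have rn : 0 <= r ^+ (n + d) by rewrite exprn_ge0.
    have h2 : C * r ^+ (n + d) * (u (n + d)%N + u (n + d).+1) <=
        C * r ^+ (n + d) * (B + B).
      have Jn : (J <= n + d)%N := leq_trans hn (leq_addr _ _).
      by rewrite ler_wpM2l ?mulr_ge0 // lerD // hB // ltnW.
    have h3 : G * B * (r ^+ (n + d) - r ^+ (n + d).+1) = 2 * C * (r ^+ (n + d) *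
      B).
      by rewrite exprS -GE; ring.
    move: ih h1 h2 h3 {rn}; rewrite !mulrBr.
    move: (r ^+ n) (r ^+ (n + d)) (r ^+ (n + d).+1) => a b c; lra.
  rewrite leNgt; apply/negP => lt.
  have e0 : 0 < (u n - B / 2) / 2 by lra.
  have [k hk uk] := small _ n e0.
  have := tele (k - n)%N; rewrite subnKC // => h.
  have h1 : G * B * (r ^+ n - r ^+ k) <= B / 2.
    have rk : 0 <= r ^+ k by rewrite exprn_ge0.
    have h2 := ler_wpM2r B0 (hJ _ hn).
    have h3 := mulr_ge0 (mulr_ge0 G0 B0) rk.
    move: h2 h3; rewrite mulrBr; move: (r ^+ n) (r ^+ k) => a b; lra.
  lra.
have A0 : 0 <= A by have /andP[a b] := uA 0%N; exact: le_trans a b.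
have iter k : forall n, (J <= n)%N -> u n <= 2^-1 ^+ k * A.
  elim: k => [|k ih]; first by move=> m _; rewrite mul1r; have /andP[] := uA m.
  move=> m hm; rewrite exprS -mulrA mulrC; apply: (half _ _ ih m hm).
  by rewrite mulr_ge0 // exprn_ge0 // invr_ge0 ler0n.
have /andP[un0 _] := uA n.
apply/eqP; rewrite eq_le un0 andbT leNgt; apply/negP => up.
have h01 : 0 <= (2^-1 : R) < 1 by apply/andP; split; lra.
have [k /(_ _ (leqnn k)) hk] := geometric_small A h01 (divr_gt0 up (ltr0n _ 2)).
have := iter k n hn; lra.
Qed.

Lemma zsummable_small (f : int -> R) (h : nat -> int) (e : R) (n : nat) :
  zsummable f -> injective h -> 0 < e -> exists2 k, (n <= k)%N & f (h k) <= e.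
Proof.
move=> hf hi e0; apply: contrapT => nex.
have big k : (n <= k)%N -> e < f (h k).
  by move=> nk; rewrite ltNge; apply/negP => fk; apply: nex; exists k.
pose N := (Num.truncn (zsum f / e)).+1.
pose s := [seq h k | k <- iota n N].
have us : uniq s by rewrite map_inj_uniq // iota_uniq.
have h1 := zsum_seq us hf.
have h2 : e * N%:R <= \sum_(x <- s) f x.
  have -> : e * N%:R = \sum_(k <- iota n N) e.
    by rewrite big_const_seq count_predT size_iota iter_addr_0 mulr_natr.
  rewrite big_map big_seq [leRHS]big_seq; apply: ler_sum => k.
  by rewrite mem_iota => /andP[/big/ltW].
have h3 : zsum f / e < N%:R by exact: truncnS_gt.
by rewrite ltr_pdivrMr // mulrC in h3; lra.
Qed.

Lemma two_sided_vanish (f : int -> R) (C r A : R) (L : nat) :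
  0 <= r < 1 -> 0 <= C -> (forall x, 0 <= f x <= A) ->
  (forall x, (L <= absz x)%N ->
     `|f x - f (x + 1)| <= C * r ^+ absz x * (f x + f (x + 1))) ->
  (forall (h : nat -> int) (e : R) n, injective h -> 0 < e ->
     exists2 k, (n <= k)%N & f (h k) <= e) ->
  exists J : nat, forall x, (J <= absz x)%N -> f x = 0.
Proof.
move=> r01 C0 fA step small; have /andP[r0 r1] := r01.
have geo (j k : nat) (y z : R) : (k <= j)%N -> 0 <= y -> 0 <= z ->
    C * r ^+ j * (y + z) <= C * r ^+ k * (y + z).
  by move=> kj y0 z0; rewrite ler_wpM2r ?addr_ge0 // ler_wpM2l // ler_wiXn2l //
    ltW.
have f0 x : 0 <= f x by have /andP[] := fA x.
have [J1 hJ1] : exists J, forall n, (J <= n)%N -> f (n + L)%N%:Z = 0.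
  apply: (@slowly_varying_vanish (fun n => f (n + L)%N%:Z) C r A r01 C0).
  - by move=> n; exact: fA.
  - move=> n; have nL : (L <= absz (n + L)%N%:Z)%N by rewrite absz_nat leq_addl.
    have := step _ nL; have -> : (n + L)%N%:Z + 1 = (n.+1 + L)%N%:Z by clear;
      lia.
    rewrite absz_nat => h.
    have := geo _ _ _ _ (leq_addr L n) (f0 (n + L)%N%:Z) (f0 (n.+1 + L)%N%:Z).
    by move: h; rewrite ler_norml => /andP[_ h] h'; lra.
  - by move=> e n e0; apply: small => // i j []; clear; lia.
have [J2 hJ2] : exists J, forall n, (J <= n)%N -> f (- (n + L)%N%:Z) = 0.
  apply: (@slowly_varying_vanish (fun n => f (- (n + L)%N%:Z)) C r A r01 C0).
  - by move=> n; exact: fA.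
  - move=> n; have nL : (L <= absz (- (n.+1 + L)%N%:Z))%N.
      by rewrite abszN absz_nat leq_addl.
    have := step _ nL.
    (* On the left a pair of neighbours is indexed by its outer member; the resulting rate
       [r ^+ (n.+1 + L)] is relaxed to [r ^+ n] by [geo]. *)
    have -> : - (n.+1 + L)%N%:Z + 1 = - (n + L)%N%:Z by clear; lia.
    rewrite abszN absz_nat => h.
    have nn : (n <= n.+1 + L)%N
      by rewrite leqW ?leq_addr // addSn leqW // leq_addr.
    have := geo _ _ _ _ nn (f0 (- (n.+1 + L)%N%:Z)) (f0 (- (n + L)%N%:Z)).
    move: h; rewrite ler_norml => /andP[h _] h'.
    rewrite [X in _ * X]addrC; lra.
  - by move=> e n e0; apply: small => // i j; clear; lia.
exists (maxn J1 J2 + L)%N => x hx.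
have [x0|x0] := leP 0 x.
  have -> : x = (absz x - L + L)%N%:Z by move: hx x0; clear; lia.
  by apply: hJ1; move: hx; clear; lia.
have -> : x = - (absz x - L + L)%N%:Z by move: hx x0; clear; lia.
by apply: hJ2; move: hx; clear; lia.
Qed.

(* tau = i t with t real, t^2 - 2 t sin phi + q^2 = 0: then (b', tau) and
   (- tau, b) are left eigenvectors of the transfer matrix with the eigenvalues
   (m - tau) / p and (m' + tau) / p, up to the phase 1 / E. *)
Section TransferStep.
Variables (p m m' b b' E E' tau v0 v1 w0 w1 r0 r1 : R[i]).
Hypotheses (mm : m * m' = 1) (EE : E * E' = 1) (pb : p * p = 1 - b * b').
Hypothesis tau2 : tau * tau = b * b' + tau * m - tau * m'.
Hypothesis eq0 : m * v0 = p * E * w0 + b * v1 + r0.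
Hypothesis eq1 : m * w1 = - b' * w0 + p * E' * v1 + r1.

Let w1E : w1 = m' * (- b' * w0 + p * E' * v1 + r1).
Proof. by rewrite -eq1 mulrA [m' * m]mulrC mm mul1r. Qed.

Let w0E : p * E * w0 = m * v0 - b * v1 - r0.
Proof. by rewrite eq0; ring. Qed.

Lemma transfer_left_eigen0 : p * E * (b' * w0 + tau * w1) =
  (m - tau) * (b' * v0 + tau * v1) - b' * (1 - tau * m') * r0 + p * E * tau * m'
    * r1.
Proof.
have -> : p * E * (b' * w0 + tau * w1) = b' * (1 - tau * m') * (p * E * w0)
   + tau * m' * (p * p) * (E * E') * v1 + p * E * tau * m' * r1.
  by rewrite w1E; ring.
rewrite w0E EE pb; ring: mm tau2.
Qed.

Lemma transfer_left_eigen1 : p * E * (- tau * w0 + b * w1) =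
  (m' + tau) * (- tau * v0 + b * v1) + (tau + b * b' * m') * r0 + p * E * b * m'
    * r1.
Proof.
have -> : p * E * (- tau * w0 + b * w1) = (- tau - b * b' * m') * (p * E * w0)
   + b * m' * (p * p) * (E * E') * v1 + p * E * b * m' * r1.
  by rewrite w1E; ring.
rewrite w0E EE pb; ring: mm tau2.
Qed.

End TransferStep.
End AsymptoticVanishing.

Section EigenfunctionDecay.
Variable R : realType.

(** The sum of the moduli of the two left eigenvectors of the free transfer matrix, evaluated at
    [(v0, v1)]. Both eigenvalues have modulus 1 when [m - tau] and [conjc m + tau] have modulus [p];
    for [cmod b < cmod tau] it is a norm on C^2. *)
Definition left_norm (b tau v0 v1 : R[i]) : R :=
  cmod (conjc b * v0 + tau * v1) + cmod (- tau * v0 + b * v1).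

Lemma cmod_triangleB (z w : R[i]) : cmod z - cmod w <= cmod (z + w).
Proof.
rewrite lerBlDr -(cmodN w); apply: le_trans (cmod_triangle _ _).
by rewrite addrK.
Qed.

Lemma left_norm_ge0 b tau v0 v1 : 0 <= left_norm b tau v0 v1.
Proof. by rewrite addr_ge0 ?cmod_ge0. Qed.

Lemma left_norm_le b tau v0 v1 :
  left_norm b tau v0 v1 <= (cmod tau + cmod b) * (cmod v0 + cmod v1).
Proof.
have := cmod_triangle (conjc b * v0) (tau * v1).
have := cmod_triangle (- tau * v0) (b * v1).
rewrite !cmodM cmod_conj cmodN /left_norm; lra.
Qed.

Lemma left_norm_ge b tau v0 v1 :
  (cmod tau - cmod b) * (cmod v0 + cmod v1) <= left_norm b tau v0 v1.
Proof.
have := cmod_triangleB (tau * v1) (conjc b * v0).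
have := cmod_triangleB (- tau * v0) (b * v1).
rewrite [tau * v1 + _]addrC !cmodM cmod_conj cmodN /left_norm; lra.
Qed.

(* With m = c + i s, the root t = s + kappa of t^2 - 2 s t + q^2 is chosen by
   giving kappa = +- sqrt (p^2 - c^2) the sign of s, so that |t| > |q|. *)
Lemma elliptic_root (p q : R) (m : R[i]) : 0 < p -> p ^+ 2 + q ^+ 2 = 1 ->
  cmod m = 1 -> `|complex.Re m| < p ->
  exists tau : R[i], [/\ `|q| < cmod tau, cmod (m - tau) = p,
    cmod (conjc m + tau) = p &
    tau * tau = (q ^+ 2)%:C + tau * m - tau * conjc m].
Proof.
move=> p0 pq m1 cp; case: m m1 cp => c s m1 /= cp.
have cs : c ^+ 2 + s ^+ 2 = 1 by have := cmod_sqr (c +i* s);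
  rewrite m1 expr1n /=.
have cp2 : c ^+ 2 < p ^+ 2.
  by rewrite -[ltLHS]real_normK ?num_real // ltr_sqr ?nnegrE // ltW.
pose k := Num.sqrt (p ^+ 2 - c ^+ 2).
have k2 : k ^+ 2 = p ^+ 2 - c ^+ 2 by rewrite sqr_sqrtr // subr_ge0 ltW.
have k0 : 0 <= k by exact: sqrtr_ge0.
have [kappa [kk sk]] : exists kappa, kappa ^+ 2 = p ^+ 2 - c ^+ 2 /\ 0 <= s *
  kappa.
  have [s0|s0] := leP 0 s; first by exists k; rewrite mulr_ge0.
  by exists (- k); rewrite sqrrN k2; split => //;
    rewrite mulr_le0 ?oppr_le0 // ltW.
exists (0 +i* (s + kappa)).
have tE : cmod (0 +i* (s + kappa)) = `|s + kappa|.
  by rewrite /cmod /= expr0n add0r sqrtr_sqr.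
have sqp z : cmod z ^+ 2 = p ^+ 2 -> cmod z = p.
  by move/eqP; rewrite eqrXn2 ?cmod_ge0 // ?(ltW p0) // => /eqP.
split.
- rewrite tE -ltr_sqr ?nnegrE // !real_normK ?num_real //.
  have : (s + kappa) ^+ 2 = s ^+ 2 + 2 * (s * kappa) + kappa ^+ 2 by ring.
  lra.
- by apply: sqp; rewrite cmod_sqr /= subr0 opprD addrA subrr add0r sqrrN kk
  addrC subrK.
- by apply: sqp; rewrite cmod_sqr /= addr0 addrA addNr add0r kk addrC subrK.
apply/eqP; rewrite eq_complex /=; apply/andP; split; apply/eqP; last by ring.
have : (s + kappa) ^+ 2 = s ^+ 2 + 2 * (s * kappa) + kappa ^+ 2 by ring.
have : (s + kappa) * s = s ^+ 2 + s * kappa by ring.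
rewrite expr2; lra.
Qed.

(** In the left eigenvectors the free part multiplies by numbers of modulus 1, so only the residuals
    [r0] and [r1] change the norm. The constant [1 + cmod tau] bounds all four of their
    coefficients, since [cmod b] and [p] are at most 1. *)
Lemma left_norm_step (p q : R) (m b E tau v0 v1 w0 w1 r0 r1 : R[i]) :
  0 < p <= 1 -> p ^+ 2 + q ^+ 2 = 1 -> cmod m = 1 -> cmod E = 1 -> cmod b = `|q|
    ->
  cmod (m - tau) = p -> cmod (conjc m + tau) = p ->
  tau * tau = (q ^+ 2)%:C + tau * m - tau * conjc m ->
  m * v0 = p%:C * E * w0 + b * v1 + r0 ->
  m * w1 = - conjc b * w0 + p%:C * conjc E * v1 + r1 ->
  `|p * left_norm b tau v0 v1 - p * left_norm b tau w0 w1| <=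
    2 * (1 + cmod tau) * (cmod r0 + cmod r1).
Proof.
move=> /andP[p0 p1] pq m1 E1 bq mt mt' tau2 eq0 eq1.
have q1 : `|q| <= 1.
  rewrite -[leRHS]ger0_norm // -ler_sqr ?nnegrE // !real_normK ?num_real //.
  by rewrite expr1n -pq lerDr sqr_ge0.
have bb : b * conjc b = (q ^+ 2)%:C by rewrite mul_conj bq real_normK ?num_real.
have mm : m * conjc m = 1 by rewrite mul_conj m1 expr1n.
have EE : E * conjc E = 1 by rewrite mul_conj E1 expr1n.
have pb : p%:C * p%:C = 1 - b * conjc b :> R[i].
  by rewrite bb -rmorphM -expr2 -(rmorph1 (real_complex R)) -rmorphB -pq addrK.
rewrite -bb in tau2.
have i0 := transfer_left_eigen0 mm EE pb tau2 eq0 eq1.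
have i1 := transfer_left_eigen1 mm EE pb tau2 eq0 eq1.
have pE (z : R[i]) : cmod (p%:C * E * z) = p * cmod z.
  by rewrite !cmodM cmodR E1 mulr1 gtr0_norm.
set F' := conjc b * w0 + tau * w1 in i0; set F := conjc b * v0 + tau * v1 in i0.
set G' := - tau * w0 + b * w1 in i1; set G := - tau * v0 + b * v1 in i1.
pose T := 1 + cmod tau.
have T1 : 1 <= T by rewrite lerDl cmod_ge0.
have tT : cmod tau <= T by rewrite lerDr.
have mc : cmod (conjc m) = 1 by rewrite cmod_conj.
have bc : cmod (conjc b) <= 1 by rewrite cmod_conj bq.
have c1 : cmod (conjc b * (1 - tau * conjc m)) <= T.
  rewrite cmodM; apply: (@le_trans _ _ (1 * cmod (1 - tau * conjc m))).
    by rewrite ler_wpM2r ?cmod_ge0.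
  rewrite mul1r; apply: le_trans (cmod_triangle _ _) _.
  by rewrite cmod1 cmodN cmodM mc mulr1.
have c2 : cmod (p%:C * E * tau * conjc m) <= T.
  rewrite cmodM mc mulr1 pE; apply: le_trans tT.
  by rewrite ler_piMl ?cmod_ge0.
have c3 : cmod (tau + b * conjc b * conjc m) <= T.
  apply: le_trans (cmod_triangle _ _) _.
  rewrite !cmodM mc mulr1 cmod_conj bq addrC lerD2r.
  by rewrite -expr2 expr_le1.
have c4 : cmod (p%:C * E * b * conjc m) <= T.
  rewrite cmodM mc mulr1 pE bq; apply: le_trans T1.
  by rewrite mulr_ile1 // ltW.
have key (a z z' k0 k1 : R[i]) : cmod a = p -> cmod k0 <= T -> cmod k1 <= T ->
    p%:C * E * z' = a * z + k0 * r0 + k1 * r1 ->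
    `|p * cmod z - p * cmod z'| <= T * (cmod r0 + cmod r1).
  move=> ap k0T k1T e.
  have e' : a * z = p%:C * E * z' + - (k0 * r0 + k1 * r1) by rewrite e; ring.
  have n0 : cmod (k0 * r0 + k1 * r1) <= T * (cmod r0 + cmod r1).
    apply: le_trans (cmod_triangle _ _) _.
    by rewrite !cmodM mulrDr lerD // ler_wpM2r ?cmod_ge0.
  have n1 := congr1 (@cmod R) e; rewrite pE -addrA in n1.
  have n2 := congr1 (@cmod R) e'; rewrite cmodM ap in n2.
  have n3 := cmod_triangle (a * z) (k0 * r0 + k1 * r1);
    rewrite cmodM ap -n1 in n3.
  have n4 := cmod_triangle (p%:C * E * z') (- (k0 * r0 + k1 * r1)).
  rewrite -n2 pE cmodN in n4.
  by rewrite ler_norml; apply/andP; split; move: n0 n3 n4; clear; lra.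
have kF : `|p * cmod F - p * cmod F'| <= T * (cmod r0 + cmod r1).
  apply: (key (m - tau) F F' (- (conjc b * (1 - tau * conjc m))) (p%:C * E * tau
    * conjc m)) => //.
    by rewrite cmodN.
  by rewrite i0; ring.
have kG : `|p * cmod G - p * cmod G'| <= T * (cmod r0 + cmod r1).
  by apply: (key (conjc m + tau) G G' (tau + b * conjc b * conjc m) (p%:C * E *
    b * conjc m)).
rewrite /left_norm -/F -/G -/F' -/G' -/T.
have -> : p * (cmod F + cmod G) - p * (cmod F' + cmod G') =
  (p * cmod F - p * cmod F') + (p * cmod G - p * cmod G') by ring.
apply: le_trans (ler_normD _ _) _; lra.
Qed.

End EigenfunctionDecay.

Section Eigenfunction.
Variable R : realType.
Variables (D : coin R) (l : R[i]) (psi : ell2 R).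
Hypothesis psi_eigen : shift (coin_op D psi) = l *: psi.
Hypothesis l1 : cmod l = 1.

Let l0 : l != 0. Proof. by rewrite -cmod_eq0 l1 oner_eq0. Qed.

Lemma eigen_eq0 x :
  l * psi (x - 1) 0 0 = D x 0 0 * psi x 0 0 + D x 0 1 * psi x 1 0.
Proof.
have := congr1 (fun u : ell2 R => u (x - 1) 0 0) psi_eigen.
by rewrite /= ell2_entryZ step0E subrK => ->.
Qed.

Lemma eigen_eq1 x :
  l * psi (x + 1) 1 0 = D x 1 0 * psi x 0 0 + D x 1 1 * psi x 1 0.
Proof.
have := congr1 (fun u : ell2 R => u (x + 1) 1 0) psi_eigen.
by rewrite /= ell2_entryZ step1E addrK => ->.
Qed.

(* (psi (x - 1) 0 0, psi x 1 0) is the vector moved by the transfer matrices. *)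
Definition link_zero (x : int) : Prop := psi (x - 1) 0 0 = 0 /\ psi x 1 0 = 0.

(** Row 0 and column 1 are unit vectors sharing the entry [A 0 1]. Hence the bound on [a_2] also
    keeps [d_2] away from 0, as the leftward recursion needs. *)
Lemma unitary_diagonal (A : 'M[R[i]]_2) :
  A \is unitarymx -> cmod (A 1 1) = cmod (A 0 0).
Proof.
move=> hA; have row : A *m (A ^t*)%sesqui = 1%:M by exact/unitarymxP.
have col : (A ^t*)%sesqui *m A = 1%:M by exact: mulmx1C.
have e2 : lift ord0 ord0 = 1 :> 'I_2 by exact/val_inj.
have h0 := congr1 (fun B : 'M[R[i]]_2 => B 0 0) row.
have h1 := congr1 (fun B : 'M[R[i]]_2 => B 1 1) col.
rewrite !mxE !big_ord_recl big_ord0 addr0 !mxE e2 /= in h0.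
rewrite !mxE !big_ord_recl big_ord0 addr0 !mxE e2 /= in h1.
have cj (z : R[i]) : z * conjc z = (cmod z ^+ 2)%:C by exact: mul_conj.
have cj' (z : R[i]) : conjc z * z = (cmod z ^+ 2)%:C by rewrite mulrC mul_conj.
have {}h0 : cmod (A 0 0) ^+ 2 + cmod (A 0 1) ^+ 2 = 1.
  apply: (@complexI R); rewrite rmorphD /= -!cj rmorph1; exact: h0.
have {}h1 : cmod (A 0 1) ^+ 2 + cmod (A 1 1) ^+ 2 = 1.
  apply: (@complexI R); rewrite rmorphD /= -!cj' rmorph1; exact: h1.
have : cmod (A 1 1) ^+ 2 = cmod (A 0 0) ^+ 2 by lra.
by move/eqP; rewrite eqrXn2 ?cmod_ge0 // => /eqP.
Qed.

Lemma link_zero_pred x : D x 0 0 != 0 -> link_zero (x + 1) -> link_zero x.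
Proof.
move=> Dx [h0 h1]; rewrite addrK in h0.
have D11 : D x 1 1 != 0.
  by rewrite -cmod_eq0 (unitary_diagonal (coin_unitary D x)) cmod_eq0.
have z1 : psi x 1 0 = 0.
  have := eigen_eq1 x; rewrite h0 h1 !mulr0 add0r => /esym/eqP.
  by rewrite mulf_eq0 (negbTE D11) => /eqP.
split=> //; have := eigen_eq0 x; rewrite h0 z1 !mulr0 addr0 => /eqP.
by rewrite mulf_eq0 (negbTE l0) => /eqP.
Qed.

Lemma link_zero_succ x : D x 0 0 != 0 -> link_zero x -> link_zero (x + 1).
Proof.
move=> Dx [h0 h1].
have z0 : psi x 0 0 = 0.
  have := eigen_eq0 x; rewrite h0 h1 !mulr0 addr0 => /esym/eqP.
  by rewrite mulf_eq0 (negbTE Dx) => /eqP.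
split; first by rewrite addrK.
have := eigen_eq1 x; rewrite z0 h1 !mulr0 addr0 => /eqP.
by rewrite mulf_eq0 (negbTE l0) => /eqP.
Qed.

Lemma link_zero_right (J : nat) (z : int) :
  (forall x, (J <= absz x)%N -> link_zero x) ->
  (forall x, z < x -> D x 0 0 != 0) -> forall x, z < x -> link_zero x.
Proof.
move=> far hD.
have all k x : (J%:Z <= x + k%:Z) -> z < x -> link_zero x.
  elim: k x => [|k ih] x h zx; first by apply: far; lia.
  by apply: link_zero_pred; [exact: hD|apply: ih; lia].
by move=> x; apply: (all (J + absz x)%N); lia.
Qed.

(** The coin at [x] leads from link [x] to link [x + 1]. Coming from the left, the coins before [z]
    thus reach link [z] itself; coming from the right, the coins after [z] stop at link [z + 1]. *)
Lemma link_zero_left (J : nat) (z : int) :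
  (forall x, (J <= absz x)%N -> link_zero x) ->
  (forall x, x < z -> D x 0 0 != 0) -> forall x, x <= z -> link_zero x.
Proof.
move=> far hD.
have all k x : (x - k%:Z <= - J%:Z) -> x <= z -> link_zero x.
  elim: k x => [|k ih] x h zx; first by apply: far; lia.
  rewrite -(subrK 1 x); apply: link_zero_succ; first by apply: hD; lia.
  by apply: ih; lia.
by move=> x; apply: (all (J + absz x)%N); lia.
Qed.

Lemma entries_zero x : psi x 0 0 = 0 -> psi x 1 0 = 0 -> psi x = 0.
Proof.
by move=> h0 h1; apply/colP => i; rewrite mxE; case: (ord2E i) => ->.
Qed.

Lemma eigenfunction_far (p q alpha beta gamma : R) :
  0 < p <= 1 -> p ^+ 2 + q ^+ 2 = 1 ->
  asymptotic D (coin0_mx p q alpha beta gamma) ->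
  `|complex.Re (l * expi (- (gamma / 2)))| < p ->
  exists J : nat, forall x, (J <= absz x)%N -> link_zero x.
Proof.
move=> hp pq [r [M [L [r01 M0 hD]]]] cp; have /andP[p0 p1] := hp.
(* Multiplying by [g'] removes the phase of the determinant of [C0] and leaves the matrix with rows
   [p E, b] and [- conjc b, p conjc E], the form used for the transfer step. *)
pose g' := expi (- (gamma / 2)); pose m := l * g'.
have m1 : cmod m = 1 by rewrite cmodM l1 cmod_expi mulr1.
have [tau [qt mt mt' tau2]] := elliptic_root p0 pq m1 cp.
pose E := expi (alpha - gamma / 2); pose b := q%:C * expi (beta - gamma / 2).
have E1 : cmod E = 1 by exact: cmod_expi.
have bq : cmod b = `|q| by rewrite cmodM cmodR cmod_expi mulr1.
set C0 := coin0_mx _ _ _ _ _ in hD.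
pose res i x := g' * ((D x - C0) *m psi x) i 0.
pose nV x := left_norm b tau (psi (x - 1) 0 0) (psi x 1 0).
have d0 : 0 < cmod tau - cmod b by rewrite bq subr_gt0.
pose g := cmod tau - cmod b; rewrite -/g in d0.
have nV_ge x : cmod (psi (x - 1) 0 0) + cmod (psi x 1 0) <= nV x / g.
  by rewrite ler_pdivlMr // mulrC; exact: left_norm_ge.
(* Component 0 at [x] belongs to link [x + 1] and component 1 to link [x], so a residual at [x] is
   controlled only by both norms together. This is why the increments are measured against
   [nV x + nV (x + 1)]. *)
have res_le i x eps : 0 <= eps -> (forall j, cmod ((D x - C0) i j) <= eps) ->
    cmod (res i x) <= eps * ((nV x + nV (x + 1)) / g).
  move=> eps0 he; rewrite cmodM cmod_expi mul1r mulmx22.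
  apply: le_trans (cmod_triangle _ _) _; rewrite !cmodM mulrDl mulrDr addrC.
  have h0 := nV_ge x; have h1 := nV_ge (x + 1); rewrite addrK in h1.
  have c0 := cmod_ge0 (psi (x - 1) 0 0); have c1 := cmod_ge0 (psi (x + 1) 1 0).
  have a0 : cmod (psi x 0 0) <= nV (x + 1) / g by lra.
  have a1 : cmod (psi x 1 0) <= nV x / g by lra.
  by apply: lerD; apply: ler_pM; rewrite ?cmod_ge0 ?he.
have eq0 x : m * psi (x - 1) 0 0 = p%:C * E * psi x 0 0 + b * psi x 1 0 + res 0
  x.
  have -> : p%:C * E = g' * C0 0 0.
    by rewrite coin0_00 /E /g' expiD; ring.
  have -> : b = g' * C0 0 1 by rewrite coin0_01 /b /g' expiD; ring.
  have -> : m * psi (x - 1) 0 0 = g' * (l * psi (x - 1) 0 0) by rewrite /m;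
    ring.
  have dE i j : (D x - C0) i j = D x i j - C0 i j by rewrite !mxE.
  by rewrite eigen_eq0 /res mulmx22 !dE; ring.
have eq1 x : m * psi (x + 1) 1 0 =
    - conjc b * psi x 0 0 + p%:C * conjc E * psi x 1 0 + res 1 x.
  have -> : p%:C * conjc E = g' * C0 1 1.
    rewrite coin0_11 /E -expiN mulrCA; congr (_ * _).
    by rewrite -expiD; congr expi; lra.
  have -> : - conjc b = g' * C0 1 0.
    have -> : conjc b = q%:C * expi (- (beta - gamma / 2)).
      by rewrite expiN /b rmorphM [X in X * _]conjc_real.
    rewrite coin0_10 mulrN; congr (- _).
    by rewrite mulrCA; congr (_ * _); rewrite -expiD; congr expi; lra.
  have -> : m * psi (x + 1) 1 0 = g' * (l * psi (x + 1) 1 0) by rewrite /m;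
    ring.
  have dE i j : (D x - C0) i j = D x i j - C0 i j by rewrite !mxE.
  by rewrite eigen_eq1 /res mulmx22 !dE; ring.
pose T := 1 + cmod tau; have T0 : 0 < T by rewrite ltr_pwDl ?cmod_ge0.
pose C := 4 * T * M / (g * p).
have gp : 0 < g * p by rewrite mulr_gt0.
have C0' : 0 <= C by rewrite divr_ge0 ?(ltW gp) // !mulr_ge0 // ltW.
have step x : (L <= absz x)%N ->
    `|nV x - nV (x + 1)| <= C * r ^+ absz x * (nV x + nV (x + 1)).
  move=> hx.
  have h := left_norm_step hp pq m1 E1 bq mt mt' tau2 (eq0 x) (eq1 x).
  rewrite -/T in h.
  have [r0 r1] := andP r01.
  have eps0 : 0 <= r ^+ absz x * M by rewrite mulr_ge0 // exprn_ge0.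
  have h0 := res_le 0 x _ eps0 (fun j => hD x 0 j hx).
  have h1 := res_le 1 x _ eps0 (fun j => hD x 1 j hx).
  have nVS : nV (x + 1) = left_norm b tau (psi x 0 0) (psi (x + 1) 1 0).
    by rewrite /nV addrK.
  rewrite -/(nV x) -nVS -mulrBr normrM (gtr0_norm p0) in h.
  rewrite -(ler_pM2l p0); apply: le_trans h _.
  have -> : p * (C * r ^+ absz x * (nV x + nV (x + 1))) =
     2 * T * (2 * (r ^+ absz x * M * ((nV x + nV (x + 1)) / g))).
    by rewrite /C; field; rewrite !lt0r_neq0.
  by rewrite ler_wpM2l ?mulr_ge0 ?(ltW T0) // mulr_natl mulr2n lerD.
have bound x : 0 <= nV x <= (cmod tau + cmod b) * (2 * (1 + N2 psi)).
  rewrite left_norm_ge0 /=; apply: le_trans (left_norm_le _ _ _ _) _.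
  rewrite ler_wpM2l ?addr_ge0 ?cmod_ge0 //.
  have e y i : cmod (psi y i 0) <= 1 + N2 psi.
    have := le_trans (cmod_le_sqnorm2 (psi y) i) (sqnorm2_le_N2 psi y).
    by have := sqr_ge0 (cmod (psi y i 0) - 1); have := N2_ge0 psi; nra.
  by rewrite mulr_natl mulr2n lerD.
have tb : 0 < cmod tau + cmod b by have := cmod_ge0 b; lra.
have small (h : nat -> int) (e : R) n : injective h -> 0 < e ->
    exists2 k, (n <= k)%N & nV (h k) <= e.
  move=> hi e0; pose eta := e / (2 * (cmod tau + cmod b)).
  have eta0 : 0 < eta by rewrite divr_gt0 // mulr_gt0.
  have hf := zsummableD (zsum_bij (addz_bij (-1)) (ell2_zsummable psi)).1
     (ell2_zsummable psi).
  have [k nk hk] := zsummable_small n hf hi (exprn_gt0 2 eta0).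
  exists k => //; apply: le_trans (left_norm_le _ _ _ _) _.
  have s0 := cmod_le_sqnorm2 (psi (h k - 1)) 0;
    have s1 := cmod_le_sqnorm2 (psi (h k)) 1.
  have n0 := sqnorm2_ge0 (psi (h k - 1)); have n1 := sqnorm2_ge0 (psi (h k)).
  have le_eta (z : R[i]) : cmod z ^+ 2 <= eta ^+ 2 -> cmod z <= eta.
    by rewrite ler_sqr ?nnegrE ?cmod_ge0 // ltW.
  have t0 : cmod (psi (h k - 1) 0 0) <= eta by apply: le_eta; lra.
  have t1 : cmod (psi (h k) 1 0) <= eta by apply: le_eta; lra.
  have -> : e = (cmod tau + cmod b) * (eta + eta).
    by rewrite /eta; field; rewrite !lt0r_neq0.
  by rewrite ler_wpM2l ?(ltW tb) // lerD.
have [J hJ] := two_sided_vanish r01 C0' bound step small.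
exists J => x /hJ nx; have := nV_ge x; rewrite nx mul0r => h.
have c0 := cmod_ge0 (psi (x - 1) 0 0); have c1 := cmod_ge0 (psi x 1 0).
by split; apply/eqP; rewrite -cmod_eq0; apply/eqP; lra.
Qed.

End Eigenfunction.

(** * Extreme points of the pairs and the conclusion *)

Lemma pair_union_max (N : nat) (y : 'I_N -> int) : (1 <= N)%N ->
  exists m, is_max (pair_union y) m.
Proof.
move=> hN; have [i _ hi] := @Order.TotalTheory.arg_maxP _ _ 'I_N (Ordinal hN)
  xpredT y isT.
exists (y i); split; first by exists i => //; right.
by move=> x [j _ [->|->]]; have := hi j isT; lia.
Qed.

Lemma pair_union_min (N : nat) (y : 'I_N -> int) : (1 <= N)%N ->
  exists m, is_min (pair_union y) m.
Proof.
move=> hN; have [i _ hi] := @Order.TotalTheory.arg_minP _ _ 'I_N (Ordinal hN)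
  xpredT y isT.
exists (y i - 1); split; first by exists i => //; left.
by move=> x [j _ [->|->]]; have := hi j isT; lia.
Qed.

Lemma i_expi (R : realType) (t : R) : 'i * expi t = expi ((2 * t + pi) / 2).
Proof.
have -> : (2 * t + pi) / 2 = t + pi / 2 by lra.
by rewrite /expi cosDpihalf sinDpihalf; simpc.
Qed.

Theorem theorem1p3 (R : realType)
  (p q alpha beta gamma beta' gamma' : R)
  (hp : 0 < p <= 1) (hq : 0 <= q <= 1) (hpq : p ^+ 2 + q ^+ 2 = 1)
  (halpha : 0 <= alpha < 2 * pi) (hbeta : 0 <= beta < 2 * pi)
  (hgamma : 0 <= gamma < 2 * pi)
  (hbeta' : 0 <= beta' < 2 * pi) (hgamma' : 0 <= gamma' < 2 * pi)
  (N : nat) (hN : (1 <= N)%N) (y : 'I_N -> int)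
  (C2 : coin R)
  (hdecay : exists rho M : R, [/\ 0 < rho, 0 < M & forall x : int,
     mx_norm (C2 x - coin0_mx p q alpha beta gamma)
       <= (M * expR (- rho * japanese_bracket R x))%:C])
  (hlower : exists delta : R, 0 < delta /\
     forall x : int, delta <= cmod (C2 x 0 0)) :
  let e := pair_union y in
  let U := walk e (coin1 beta' gamma') C2 in
  let is_pm_ie (l : R[i]) :=
    l = 'i * expi (gamma' / 2) \/ l = - ('i * expi (gamma' / 2)) in
  [/\ essential_spectrum U = @expi R @` arcs p gamma,
      forall l : R[i], is_pm_ie l ->
        point_spectrum U l /\
        exists Psi : ell2 R, eigenvector U l Psi /\ supp Psi `<=` e
    & (arcs p gamma `\` arc_ends p gamma) ((gamma' + pi) / 2) ->
      forall l : R[i], is_pm_ie l ->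
        (point_spectrum U `&`
           (essential_spectrum U `\` thresholds U p gamma)) l /\
        exists xmax xmin : int, [/\ is_max e xmax, is_min e xmin &
          forall Psi : ell2 R, eigenvector U l Psi ->
            forall x : int, xmax < x \/ x < xmin -> Psi x = 0]].
Proof.
move=> e U is_pm_ie.
have /andP[p0 p1] := hp; have p01 : 0 <= p <= 1 by rewrite ltW.
have hD : asymptotic (walk_coin e (coin1 beta' gamma') C2)
    (coin0_mx p q alpha beta gamma).
  exact/asymptotic_walk/asymptotic_of_decay.
have ess : essential_spectrum U = @expi R @` arcs p gamma.
  exact: essential_spectrumE hpq hp hD.
have theta : (2 * (gamma' / 2) + pi) / 2 = (gamma' + pi) / 2 by lra.
have pm_expi l : is_pm_ie l ->
    l = expi ((gamma' + pi) / 2) \/ l = - expi ((gamma' + pi) / 2).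
  by case=> ->; rewrite i_expi theta; [left|right].
have pm_sqr l : is_pm_ie l -> l ^+ 2 = - expi gamma'.
  have -> : expi gamma' = expi (gamma' / 2) ^+ 2
    by rewrite expr2 -expiD -splitr.
  by case=> ->; rewrite ?sqrrN exprMn sqr_i mulN1r.
have trap l : is_pm_ie l -> exists Psi : ell2 R, eigenvector U l Psi /\ supp Psi
  `<=` e.
  move=> hl; pose i0 := Ordinal hN.
  have e0 : e (y i0) by exists i0 => //; right.
  have e1 : e (y i0 - 1) by exists i0 => //; left.
  exists (trapped beta' (y i0) (pm_sqr _ hl)); split.
    exact: trapped_eigenvector.
  exact: trapped_supp.
have point l : is_pm_ie l -> point_spectrum U l.
  by move=> /trap[Psi [hPsi _]]; exists Psi.
split=> //; first by move=> l hl; split; [exact: point|exact: trap].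
move=> [hin hends] l hl.
(* For the eigenvalue with the minus sign the angle [(gamma' + pi) / 2 + pi] may leave the intervals
   defining the arcs. The absolute value of this real part is the same for both signs, and it
   decides membership in the bands and at the thresholds. *)
have Re_l : `|complex.Re (l * expi (- (gamma / 2)))| = `|cos ((gamma' + pi) / 2
  - gamma / 2)|.
  have [->|->] := pm_expi l hl; first by rewrite Re_expiB.
  have ReN (z : R[i]) : complex.Re (- z) = - complex.Re z by case: z.
  by rewrite mulNr ReN normrN Re_expiB.
have lt_p : `|complex.Re (l * expi (- (gamma / 2)))| < p.
  by rewrite Re_l; exact: arcs_interior_cos p01 hin hends.
have l1 : cmod l = 1 by have [->|->] := pm_expi l hl; rewrite ?cmodN cmod_expi.
split.
  split; first exact: point.
  split.
    rewrite ess; have [t ht <-] := arcs_of_Re p01 l1 (ltW lt_p).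
    by exists t.
  move=> [_ [t ht tl]]; move: lt_p; rewrite -tl Re_expiB.
  by rewrite (arc_ends_cos p01 ht) ltxx.
have [xmax [emax umax]] := pair_union_max y hN.
have [xmin [emin umin]] := pair_union_min y hN.
exists xmax, xmin; split=> // Psi [_ hPsi].
have eig : shift (coin_op (walk_coin e (coin1 beta' gamma') C2) Psi) = l *: Psi.
  by rewrite -hPsi /U walkE.
have [J far] := eigenfunction_far eig l1 hp hpq hD lt_p.
have [delta [delta0 hdelta]] := hlower.
have nz x : ~ e x -> walk_coin e (coin1 beta' gamma') C2 x 0 0 != 0.
  move=> ex; rewrite /= memNset // -cmod_gt0.
  exact: lt_le_trans delta0 (hdelta x).
have right x : xmax < x -> link_zero Psi x.
  apply: (link_zero_right eig l1 far) => z hz; apply: nz => /umax.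
  by rewrite leNgt hz.
have left x : x <= xmin -> link_zero Psi x.
  apply: (link_zero_left eig l1 far) => z hz; apply: nz => /umin.
  by rewrite leNgt hz.
move=> x [hx|hx]; apply: entries_zero.
- have hx1 : xmax < x + 1 by apply: (lt_trans hx); rewrite ltrDl.
  have [h _] := right _ hx1; by rewrite addrK in h.
- by have [] := right x hx.
- have hx1 : x + 1 <= xmin by rewrite lezD1.
  by have [h _] := left _ hx1; rewrite addrK in h.
- by have [] := left x (ltW hx).
Qed.
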